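(* Let $c$ be a Coxeter element of $W$ and let $\mathcal{F}_c^\Pi$ be the collection of all cones in $P_\mathbb{R}$ of the form $\sum_{\lambda\in S}\mathbb{R}_{\ge0}\lambda$, where $S$ ranges over all subsets of $\Pi(c)$ consisting of pairwise $c$-compatible weights (including $S=\emptyset$). Then $\mathcal{F}_c^\Pi$ is a complete simplicial fan in $P_\mathbb{R}$.
   Context: Let $I$ be a finite type Dynkin diagram (identified with its vertex set, $|I|=n$), with crystallographic root system $\Phi$, simple roots $\{\alpha_i\}_{i\in I}$, fundamental weights $\{\omega_i\}_{i\in I}$, root lattice $Q$, weight lattice $P$, $P_\mathbb{R}=P\otimes\mathbb{R}$, Weyl group $W$ generated by simple reflections $s_i$, and longest element $w_0$. For $i\in I$ let $i^*$ be defined by $\omega_{i^*}=-w_0\omega_i$. A Coxeter element $c\in W$ is a product of all simple reflections, each appearing exactly once. $h(i;c)$ is the minimal positive integer with $c^{h(i;c)}\omega_i=-\omega_{i^*}$. Put $\Pi(c):=\{c^m\omega_i: i\in I,\ 0\le m\le h(i;c)\}$. Define $\tau_c:\Pi(c)\to\Pi(c)$ by $\tau_c(-\omega_i)=\omega_i$ and $\tau_c(\lambda)=c\lambda$ otherwise. For $\gamma\in Q$, $[\gamma;\alpha_i]$ is the coefficient of $\alpha_i$ in $\gamma$ in the basis of simple roots, and $[x]_+=\max\{x,0\}$. The $c$-compatibility degree is the unique function $(\bullet||\bullet)_c:\Pi(c)\times\Pi(c)\to\mathbb{Z}$ with $(\tau_c\lambda||\tau_c\mu)_c=(\lambda||\mu)_c$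 and $(\omega_i||\lambda)_c=[(c^{-1}-1)\lambda;\alpha_i]_+$. Weights $\lambda,\mu$ are $c$-compatible if $(\lambda||\mu)_c=0$ (a symmetric relation). *)

(* Defs.v *)
(* Weights are column vectors of coordinates in the basis of
   fundamental weights (omega_i = i-th unit vector) of P_R = R^n. *)
From HB Require Import structures.
From mathcomp Require Import all_boot all_order all_algebra.
From mathcomp Require Import reals.
Set Implicit Arguments. Unset Strict Implicit. Unset Printing Implicit Defensive.
Import Order.TTheory GRing.Theory Num.Theory.
Local Open Scope ring_scope.

Section Coxeter.
Variables (R : realType) (n : nat) (A : 'M[int]_n).

(* A is a Cartan matrix of finite type: a generalized Cartan matrix which is
   symmetrizable (diag(d) A symmetric, d > 0) with positive definite
   symmetrization.  Convention: A j i = <alpha_i, alpha_j^vee>. *)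
Definition finite_cartan : Prop :=
  (forall i, A i i = 2) /\
  (forall i j, i != j -> A i j <= 0) /\
  (forall i j, A i j = 0 <-> A j i = 0) /\
  exists d : 'I_n -> R,
    (forall i, 0 < d i) /\
    (forall i j, d i * (A i j)%:~R = d j * (A j i)%:~R) /\
    (forall x : 'I_n -> R, (exists i, x i != 0) ->
       0 < \sum_i \sum_j x i * (d i * (A i j)%:~R) * x j).

Definition omega (i : 'I_n) : 'cV[R]_n := delta_mx i 0.
Definition alpha (i : 'I_n) : 'cV[R]_n := \col_j (A j i)%:~R.
(* simple reflection s_i : lambda |-> lambda - <lambda, alpha_i^vee> alpha_i *)
Definition sref (i : 'I_n) : 'M[R]_n :=
  1%:M - alpha i *m (delta_mx 0 i : 'M[R]_(1, n)).
Definition wordmx (s : seq 'I_n) : 'M[R]_n :=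
  foldr (fun i M => sref i *m M) 1%:M s.

Definition longest (w0 : 'M[R]_n) : Prop :=
  exists s, w0 = wordmx s /\
    (forall t, wordmx t = w0 -> (size s <= size t)%N) /\
    (forall t, exists t', wordmx t' = wordmx t /\ (size t' <= size s)%N).

Definition star (i j : 'I_n) : Prop :=
  exists w0, longest w0 /\ w0 *m omega i = - omega j.

Definition coxeter (c : 'M[R]_n) : Prop :=
  exists s, perm_eq s (enum 'I_n) /\ c = wordmx s.

Definition cpow (c : 'M[R]_n) (m : nat) (v : 'cV[R]_n) : 'cV[R]_n :=
  iter m (mulmx c) v.

Definition hnum (c : 'M[R]_n) (i : 'I_n) (h : nat) : Prop :=
  (0 < h)%N /\ exists j, star i j /\ cpow c h (omega i) = - omega j /\
    (forall m, (0 < m)%N -> (m < h)%N -> cpow c m (omega i) != - omega j).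

Definition inPi (c : 'M[R]_n) (lam : 'cV[R]_n) : Prop :=
  exists i h, hnum c i h /\ exists2 m, (m <= h)%N & lam = cpow c m (omega i).

Definition tau (c : 'M[R]_n) (lam : 'cV[R]_n) : 'cV[R]_n :=
  if [exists i, lam == - omega i] then - lam else c *m lam.

(* [gamma; alpha_i] : coefficient of alpha_i in gamma *)
Definition cartanR : 'M[R]_n := \matrix_(j, k) (A j k)%:~R.
Definition rootcoef (gam : 'cV[R]_n) (i : 'I_n) : R := (invmx cartanR *m gam) i 0.

Definition compat_degree (c : 'M[R]_n) (f : 'cV[R]_n -> 'cV[R]_n -> int) : Prop :=
  (forall lam mu, inPi c lam -> inPi c mu -> f (tau c lam) (tau c mu) = f lam mu) /\
  (forall i lam, inPi c lam ->
     (f (omega i) lam)%:~R = Num.max 0 (rootcoef ((invmx c - 1%:M) *m lam) i)).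

Definition compatible (c : 'M[R]_n) (lam mu : 'cV[R]_n) : Prop :=
  exists f, compat_degree c f /\ f lam mu = 0.

Definition cone (S : seq 'cV[R]_n) (x : 'cV[R]_n) : Prop :=
  exists t : 'I_(size S) -> R, (forall k, 0 <= t k) /\
    x = \sum_(k < size S) t k *: nth 0 S k.

Definition cfan (c : 'M[R]_n) (C : 'cV[R]_n -> Prop) : Prop :=
  exists S : seq 'cV[R]_n,
    (forall lam, lam \in S -> inPi c lam) /\
    (forall lam mu, lam \in S -> mu \in S -> lam != mu -> compatible c lam mu) /\
    (forall x, C x <-> cone S x).

End Coxeter.

Section Fan.
Variables (R : realType) (n : nat).

Definition lin_indep (S : seq 'cV[R]_n) : Prop :=
  forall t : 'I_(size S) -> R, \sum_(k < size S) t k *: nth 0 S k = 0 ->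
    forall k, t k = 0.

Definition face (C G : 'cV[R]_n -> Prop) : Prop :=
  exists phi : 'rV[R]_n, (forall x, C x -> 0 <= (phi *m x) 0 0) /\
    (forall x, G x <-> (C x /\ (phi *m x) 0 0 = 0)).

Definition simplicial_cone (C : 'cV[R]_n -> Prop) : Prop :=
  exists B, lin_indep B /\ forall x, C x <-> cone B x.

Definition complete_simplicial_fan (F : ('cV[R]_n -> Prop) -> Prop) : Prop :=
  (forall C, F C -> simplicial_cone C) /\
  (forall C G, F C -> face C G -> F G) /\
  (forall C D, F C -> F D ->
     face C (fun x => C x /\ D x) /\ face D (fun x => C x /\ D x)) /\
  (forall x, exists C, F C /\ C x).

End Fan.

(* Main.v *)
(* Write b(x) = (c^-1 - 1) x.  Then Pi(c) consists of the fundamental weights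
   and of the x for which b(x) is a positive root, and up to the length of roots
   the compatibility degree of x and y is the larger of the positive parts of
   (b(x), y) and (b(y), x), where a term is dropped if its b is that of a
   fundamental weight.  When i is the first letter of the word of c, replacing c
   by s_i c s_i matches Pi(c) with Pi(s_i c s_i) through a piecewise linear
   bijection of the whole space which preserves compatibility and is linear on
   each cone.  The coefficient of omega_i in a compatible expansion of x is then
   the positive part of the i-th coordinate of x.  Rotating the word brings every
   element of Pi(c) to such a position, which gives uniqueness of expansions.
   Conversely, every nonzero x meets a positive coordinate during the rotation;
   one subtracts that multiple of omega_i and expands the rest, whose i-th
   coordinate is 0, in the diagram where the vertex i is disconnected.
   Existence and uniqueness of expansions amount to a complete simplicial fan. *)
Require Import Defs.
From HB Require Import structures.
From mathcomp Require Import all_boot all_order all_algebra.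
From mathcomp Require Import boolp reals.
From mathcomp Require Import ring lra zify.
Set Implicit Arguments. Unset Strict Implicit. Unset Printing Implicit Defensive.
Import Order.TTheory GRing.Theory Num.Theory.
Local Open Scope ring_scope.

(** * Roots, weights and the invariant form *)

(** Finiteness of W drives every termination argument: a real sequence that is both monotone and
    periodic is constant, so an orbit of c cannot move forever in the same direction, and must meet
    the weight or the sign that is looked for. The mutation is s_i plus the positive part of x_i
    times a fixed vector. On a compatible set that positive part is additive: either omega_i is a
    member and all other members have i-th coordinate 0, or every member has i-th coordinate at most
    0. This is why expansions can be transported. A symmetrized degree makes symmetry automatic, and
    rescaling by root lengths does not affect its zeros. Since compatibility asks for some function
    obeying the defining rules, one must both construct such a function and show that the zeros of
    any such function are zeros of the symmetrized degree. Disconnecting a vertex, rather than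
    passing to a subdiagram, keeps the ambient space and the words unchanged during the
    induction. *)

(* [d] is the symmetrizer, that is [d i = (alpha_i, alpha_i) / 2]. *)
Definition cartan_datum (R : realType) (n : nat) (A : 'M[int]_n) (d : 'I_n -> R) : Prop :=
  [/\ forall i, A i i = 2,
      forall i j, i != j -> A i j <= 0,
      forall i, 0 < d i,
      forall i j, d i * (A i j)%:~R = d j * (A j i)%:~R
    & forall x : 'I_n -> R, (exists i, x i != 0) ->
       0 < \sum_i \sum_j x i * (d i * (A i j)%:~R) * x j].

(* The W-invariant form, normalized by [(alpha_i, omega_j) = d_i delta_ij]. *)
Definition wform (R : realType) (n : nat) (A : 'M[int]_n) (d : 'I_n -> R)
  (x y : 'cV[R]_n) : R := \sum_i d i * rootcoef A x i * y i 0.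

Section Basics.
Variables (R : realType) (n : nat) (A : 'M[int]_n) (d : 'I_n -> R).
Hypothesis HA : cartan_datum A d.
Local Notation om := (@omega R n).
Local Notation al := (@alpha R n A).
Local Notation sr := (@sref R n A).
Local Notation W := (@wordmx R n A).
Local Notation rc := (@rootcoef R n A).
Local Notation B := (wform A d).
Implicit Types (x y : 'cV[R]_n) (s t : seq 'I_n) (i j : 'I_n).

Lemma cartanR_unit : cartanR R A \in unitmx.
Proof.
case: HA => _ _ _ _ Hpos.
rewrite unitmxE unitfE -det_tr; apply/negP => /det0P [v v0 Hv].
have Hx j : \sum_k (A j k)%:~R * v 0 k = 0.
  have /matrixP /(_ 0 j) := Hv; rewrite [LHS]mxE [RHS]mxE => Hj.
  by rewrite -[RHS]Hj; apply: eq_bigr => k _; rewrite !mxE mulrC.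
have : exists i, v 0 i != 0.
  apply/existsP; apply: contraNT v0; rewrite negb_exists => /forallP H.
  by apply/eqP/rowP => i; rewrite mxE; apply/eqP; rewrite -[_ == _]negbK H.
move=> /(Hpos (fun i => v 0 i)); rewrite big1 ?ltxx // => i _.
under eq_bigr => j _ do rewrite -!mulrA.
by rewrite -mulr_sumr -mulr_sumr Hx !mulr0.
Qed.

Lemma omegaE i j : om i j 0 = (j == i)%:R.
Proof. by rewrite mxE eqxx andbT. Qed.

Lemma alphaE i j : al i j 0 = (A j i)%:~R.
Proof. by rewrite mxE. Qed.

Lemma alpha_cartanR i : al i = cartanR R A *m om i.
Proof.
apply/colP => j; rewrite !mxE (bigD1 i) //= !mxE !eqxx mulr1 big1 ?addr0 //.
by move=> k ki; rewrite !mxE (negbTE ki) mulr0.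
Qed.

Lemma omega_eq0 i : om i != 0.
Proof.
apply/eqP => /colP /(_ i); rewrite omegaE eqxx mxE => /eqP.
by rewrite oner_eq0.
Qed.

Lemma omega_inj i j : om i = om j -> i = j.
Proof.
move=> /colP /(_ i); rewrite !omegaE eqxx.
by case: eqP => // _ /eqP; rewrite oner_eq0.
Qed.

Lemma rootcoefD x y i : rc (x + y) i = rc x i + rc y i.
Proof. by rewrite /rootcoef mulmxDr mxE. Qed.

Lemma rootcoefN x i : rc (- x) i = - rc x i.
Proof. by rewrite /rootcoef mulmxN mxE. Qed.

Lemma rootcoefZ a x i : rc (a *: x) i = a * rc x i.
Proof. by rewrite /rootcoef -scalemxAr mxE. Qed.

Lemma rootcoef0 i : rc 0 i = 0.
Proof. by rewrite /rootcoef mulmx0 mxE. Qed.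

Lemma rootcoefB x y i : rc (x - y) i = rc x i - rc y i.
Proof. by rewrite rootcoefD rootcoefN. Qed.

Lemma rootcoef_alpha i j : rc (al i) j = (j == i)%:R.
Proof. by rewrite /rootcoef alpha_cartanR mulKmx ?cartanR_unit // omegaE. Qed.

Lemma rootcoef_expand x : x = \sum_i rc x i *: al i.
Proof.
rewrite -[LHS](mulKVmx cartanR_unit).
apply/colP => j; rewrite summxE mxE; apply: eq_bigr => k _.
by rewrite [in RHS]mxE alphaE mulrC; congr (_ * _); rewrite mxE.
Qed.

Lemma rootcoef_inj x y : (forall i, rc x i = rc y i) -> x = y.
Proof.
move=> H; rewrite (rootcoef_expand x) (rootcoef_expand y).
by apply: eq_bigr => i _; rewrite H.
Qed.

Lemma srefE i x : sr i *m x = x - x i 0 *: al i.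
Proof.
rewrite /sref mulmxBl mul1mx -mulmxA; congr (_ - _).
apply/colP => j; rewrite mxE big_ord1 [RHS]mxE mulrC; congr (_ * _).
rewrite mxE (bigD1 i) //= mxE !eqxx mul1r big1 ?addr0 // => k ki.
by rewrite mxE (negbTE ki) andbF mul0r.
Qed.

Lemma sref_mulmxE i x j : (sr i *m x) j 0 = x j 0 - x i 0 * (A j i)%:~R.
Proof. by rewrite srefE 3!mxE alphaE. Qed.

Lemma sref_alpha i : sr i *m al i = - al i.
Proof.
case: HA => H2 _ _ _ _.
by rewrite srefE alphaE H2 scaler_nat mulr2n opprD addrA subrr add0r.
Qed.

Lemma sref_omega i : sr i *m om i = om i - al i.
Proof. by rewrite srefE omegaE eqxx scale1r. Qed.

Lemma sref_omega_neq i j : i != j -> sr i *m om j = om j.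
Proof. by move=> ij; rewrite srefE omegaE (negbTE ij) scale0r subr0. Qed.

Lemma sref_coord i x : (sr i *m x) i 0 = - x i 0.
Proof.
case: HA => H2 _ _ _ _.
by rewrite srefE !mxE H2 mulr_natr mulr2n opprD addrA subrr add0r.
Qed.

Lemma srefK i x : sr i *m (sr i *m x) = x.
Proof.
by rewrite {1}srefE sref_coord srefE scaleNr opprK subrK.
Qed.

Lemma sref_sref i : sr i *m sr i = 1%:M.
Proof.
apply/matrixP => j k.
have /colP/(_ j) := srefK i (delta_mx k 0).
by rewrite mulmxA -colE [LHS]mxE => ->; rewrite !mxE eqxx andbT.
Qed.

Lemma rootcoef_sref i x j : rc (sr i *m x) j = rc x j - x i 0 * (j == i)%:R.
Proof. by rewrite srefE rootcoefB rootcoefZ rootcoef_alpha. Qed.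

Lemma wordmx_cons i s : W (i :: s) = sr i *m W s.
Proof. by []. Qed.

Lemma wordmx_cat s t : W (s ++ t) = W s *m W t.
Proof.
elim: s => [|i s IH] /=; first by rewrite mul1mx.
by rewrite IH mulmxA.
Qed.

Lemma wordmx1 i : W [:: i] = sr i.
Proof. by rewrite /= mulmx1. Qed.

Lemma wordmx_rcons s i : W (rcons s i) = W s *m sr i.
Proof. by rewrite -cats1 wordmx_cat wordmx1. Qed.

Lemma wordmx_rev s : W (rev s) *m W s = 1%:M.
Proof.
elim: s => [|i s IH] /=; first by rewrite mul1mx.
by rewrite rev_cons wordmx_rcons -mulmxA (mulmxA (sr i)) sref_sref mul1mx.
Qed.

Lemma wordmx_revK s : W s *m W (rev s) = 1%:M.
Proof. by rewrite -{1}(revK s) wordmx_rev. Qed.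

Lemma wordmxK s x : W (rev s) *m (W s *m x) = x.
Proof. by rewrite mulmxA wordmx_rev mul1mx. Qed.

Lemma wordmxVK s x : W s *m (W (rev s) *m x) = x.
Proof. by rewrite mulmxA wordmx_revK mul1mx. Qed.

Lemma wordmx_unit s : W s \in unitmx.
Proof. by have /mulmx1_unit [] := wordmx_rev s. Qed.

Lemma invmx_wordmx s : invmx (W s) = W (rev s).
Proof.
by rewrite -[LHS]mul1mx -(wordmx_rev s) mulmxK ?wordmx_unit.
Qed.

Lemma wordmx_inj s x y : W s *m x = W s *m y -> x = y.
Proof. by move=> H; rewrite -(wordmxK s x) H wordmxK. Qed.

Lemma wordmx_omega_notin s j : j \notin s -> W s *m om j = om j.
Proof.
elim: s => [|i s IH] /=; first by rewrite mul1mx.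
rewrite inE negb_or => /andP [ji js].
by rewrite -mulmxA IH // sref_omega_neq // eq_sym.
Qed.

Lemma rootcoef_wordmx_notin s x j : j \notin s -> rc (W s *m x) j = rc x j.
Proof.
elim: s x => [|i s IH] x /=; first by rewrite mul1mx.
rewrite inE negb_or => /andP [ji js].
by rewrite -mulmxA rootcoef_sref (negbTE ji) mulr0 subr0 IH.
Qed.

Lemma wformDl x y z : B (x + y) z = B x z + B y z.
Proof.
rewrite /wform -big_split; apply: eq_bigr => i _ /=.
by rewrite rootcoefD mulrDr mulrDl.
Qed.

Lemma wformZl a x z : B (a *: x) z = a * B x z.
Proof.
rewrite /wform mulr_sumr; apply: eq_bigr => i _ /=.
by rewrite rootcoefZ; ring.
Qed.

Lemma wformE x y : B x y = \sum_i \sum_j rc x i * (d i * (A i j)%:~R) * rc y j.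
Proof.
rewrite /wform; apply: eq_bigr => i _.
rewrite [in LHS](rootcoef_expand y) summxE mulr_sumr; apply: eq_bigr => j _.
by rewrite !mxE; ring.
Qed.

Lemma wformC x y : B x y = B y x.
Proof.
case: HA => _ _ _ Hs _.
rewrite !wformE exchange_big; apply: eq_bigr => i _; apply: eq_bigr => j _ /=.
by rewrite Hs; ring.
Qed.

Lemma wform0l z : B 0 z = 0.
Proof. by rewrite -(scale0r 0) wformZl mul0r. Qed.

Lemma wformNl x z : B (- x) z = - B x z.
Proof. by rewrite -scaleN1r wformZl mulN1r. Qed.

Lemma wformBl x y z : B (x - y) z = B x z - B y z.
Proof. by rewrite wformDl wformNl. Qed.

Lemma wformDr x y z : B z (x + y) = B z x + B z y.
Proof. by rewrite wformC wformDl !(wformC z). Qed.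

Lemma wformZr a x z : B z (a *: x) = a * B z x.
Proof. by rewrite wformC wformZl (wformC z). Qed.

Lemma wformNr x z : B z (- x) = - B z x.
Proof. by rewrite wformC wformNl (wformC z). Qed.

Lemma wformBr x y z : B z (x - y) = B z x - B z y.
Proof. by rewrite wformDr wformNr. Qed.

Lemma wform_alphal i x : B (al i) x = d i * x i 0.
Proof.
rewrite /wform (bigD1 i) //= rootcoef_alpha eqxx mulr1 big1 ?addr0 // => j ji.
by rewrite rootcoef_alpha (negbTE ji) mulr0 mul0r.
Qed.

Lemma wform_omegar i x : B x (om i) = d i * rc x i.
Proof.
rewrite /wform (bigD1 i) //= omegaE eqxx mulr1 big1 ?addr0 // => j ji.
by rewrite omegaE (negbTE ji) mulr0.
Qed.

Lemma wform_gt0 x : x != 0 -> 0 < B x x.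
Proof.
case: HA => _ _ _ _ Hpos x0; rewrite wformE; apply: Hpos.
apply/existsP; apply: contraNT x0; rewrite negb_exists => /forallP H.
apply/eqP/rootcoef_inj => i; rewrite rootcoef0; apply/eqP.
by rewrite -[_ == _]negbK H.
Qed.

Lemma wform_ge0 x : 0 <= B x x.
Proof.
have [->|/wform_gt0/ltW //] := eqVneq x 0; by rewrite wform0l.
Qed.

Lemma wform_alpha i : B (al i) (al i) = 2 * d i.
Proof. by case: HA => H2 _ _ _ _; rewrite wform_alphal alphaE H2 mulrC. Qed.

Lemma wform_sref i x y : B (sr i *m x) (sr i *m y) = B x y.
Proof.
rewrite !srefE !(wformBl, wformBr, wformZl, wformZr) wform_alpha.
by rewrite (wformC x (al i)) !wform_alphal; ring.
Qed.

Lemma wform_wordmx s x y : B (W s *m x) (W s *m y) = B x y.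
Proof.
elim: s => [|i s IH] /=; first by rewrite !mul1mx.
by rewrite -!mulmxA wform_sref.
Qed.

Lemma wform_wordmxl s x y : B (W s *m x) y = B x (W (rev s) *m y).
Proof. by rewrite -(wform_wordmx s x) wordmxVK. Qed.

End Basics.

(** * Roots are positive or negative *)

Section Length.
Variables (R : realType) (n : nat) (A : 'M[int]_n).
Local Notation W := (@wordmx R n A).
Implicit Types (s t : seq 'I_n).

Lemma word_length_ex s : exists k, [exists t : k.-tuple 'I_n, W t == W s].
Proof. by exists (size s); apply/existsP; exists (in_tuple s). Qed.

(** Minimizing over tuples of a given size makes existence a boolean, as [ex_minn] requires. The
    argument is a word, but the value depends only on its matrix. *)
Definition word_length s : nat := ex_minn (word_length_ex s).

Lemma word_length_le s t : W t = W s -> (word_length s <= size t)%N.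
Proof.
move=> H; rewrite /word_length; case: ex_minnP => k _; apply.
by apply/existsP; exists (in_tuple t); apply/eqP.
Qed.

Lemma word_length_reduced s : exists2 t, W t = W s & size t = word_length s.
Proof.
rewrite /word_length; case: ex_minnP => k /existsP [t /eqP Ht] _.
by exists t => //; rewrite size_tuple.
Qed.

Lemma word_length_eq s t : W s = W t -> word_length s = word_length t.
Proof.
move=> H; apply/eqP; rewrite eqn_leq; apply/andP; split.
  by have [u Hu <-] := word_length_reduced t; apply: word_length_le; rewrite Hu.
by have [u Hu <-] := word_length_reduced s; apply: word_length_le; rewrite Hu.
Qed.

End Length.

(* The alternating word of length [k] whose last letter is [j]. *)
Fixpoint altword (T : Type) (i j : T) (k : nat) : seq T :=
  if k is k'.+1 then (if odd k' then i else j) :: altword i j k' else [::].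

Section AltWord.
Variables (T : Type).
Implicit Types (i j : T).

Lemma size_altword i j k : size (altword i j k) = k.
Proof. by elim: k => //= k ->. Qed.

Lemma altword_rcons i j k : altword i j k.+1 = rcons (altword j i k) j.
Proof. by elim: k => // k IH; rewrite [LHS]/= -/(altword i j k.+1) IH /= if_neg. Qed.

Lemma altword_suffix i j k m : (m <= k)%N ->
  exists2 t, altword i j k = t ++ altword i j m & size t = (k - m)%N.
Proof.
move=> /subnK <-; elim: (k - m)%N => [|l [t /= Ht St]].
  by exists [::]; rewrite ?subnn.
exists ((if odd (l + m) then i else j) :: t); first by rewrite ?addSn /= Ht.
by rewrite /= St; lia.
Qed.

End AltWord.

Definition pos_vec (R : realType) (n : nat) (A : 'M[int]_n) (x : 'cV[R]_n) : Prop :=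
  forall i, 0 <= rootcoef A x i.

Section Positivity.
Variables (R : realType) (n : nat) (A : 'M[int]_n) (d : 'I_n -> R).
Hypothesis HA : cartan_datum A d.
Local Notation al := (@alpha R n A).
Local Notation sr := (@sref R n A).
Local Notation W := (@wordmx R n A).
Local Notation rc := (@rootcoef R n A).
Local Notation len := (@word_length R n A).
Implicit Types (x y : 'cV[R]_n) (s t : seq 'I_n) (i j : 'I_n).

Lemma word_length_cat s t : (len (s ++ t) <= len s + size t)%N.
Proof.
have [u Hu <-] := word_length_reduced R A s; rewrite -size_cat.
by apply: word_length_le; rewrite !wordmx_cat Hu.
Qed.

Lemma wordmx_cancel s i t : W (rcons s i ++ i :: t) = W (s ++ t).
Proof.
rewrite !wordmx_cat wordmx_rcons wordmx_cons -mulmxA (mulmxA (sr i)).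
by rewrite (sref_sref HA) mul1mx.
Qed.

Lemma word_length_rcons s i : (len s <= (len (rcons s i)).+1)%N.
Proof.
rewrite (@word_length_eq _ _ _ s (rcons s i ++ [:: i])); last first.
  by rewrite wordmx_cancel cats0.
by rewrite -addn1; apply: word_length_cat.
Qed.

(** Descent on the length of [v]. If the letter that prolongs the alternating word to the left
    shortens [v], it is moved into that word. The other letter cannot shorten [v], since it would
    cancel the first alternating letter and make [s] too short. *)
Lemma altword_factor s i j : (exists v k,
    W s = W (v ++ altword i j k.+1) /\ len s = (len v + k.+1)%N) ->
  exists v k, [/\ W s = W (v ++ altword i j k.+1), len s = (len v + k.+1)%N,
    (len v <= len (rcons v i))%N & (len v <= len (rcons v j))%N].
Proof.
move=> [v [k [Hs Hl]]]; have [N] := ubnP (len v).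
elim: N v k Hs Hl => // N IH v k Hs Hl HN.
set x := if odd k then j else i; set y := if odd k then i else j.
have [Hx|Hx] := ltnP (len (rcons v x)) (len v).
  have Hv := word_length_rcons v x.
  apply: (IH (rcons v x) k.+1); last by lia.
    have -> : altword i j k.+2 = x :: altword i j k.+1 by rewrite /= if_neg.
    by rewrite wordmx_cancel.
  by lia.
have Hy : (len v <= len (rcons v y))%N.
  rewrite leqNgt; apply/negP => Hy.
  suff : (len s <= len (rcons v y) + k)%N by lia.
  rewrite -{1}(size_altword i j k).
  apply: leq_trans (word_length_cat _ _).
  by rewrite (@word_length_eq _ _ _ s (rcons v y ++ altword i j k)) // Hs -cat_rcons.
exists v, k; split => //; move: Hx Hy; rewrite /x /y; by case: ifP.
Qed.

Lemma rank2_cases i j : i != j -> 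
  exists ab, [/\ ab \in [:: (0, 0); (-1, -1); (-1, -2); (-2, -1); (-1, -3); (-3, -1)],
   A i j = ab.1 & A j i = ab.2].
Proof.
case: (HA) => H2 Hn Hd Hs _ ij.
exists (A i j, A j i); split => //.
have Ha := Hn _ _ ij; have Hb : A j i <= 0 by apply: Hn; rewrite eq_sym.
have hi := Hd i; have hj := Hd j; have hs := Hs i j.
have lt4 : A i j * A j i < 4.
  (* The norm of this vector is 2 d_j (4 - A_ij A_ji), whence the bound on the product. *)
  have x0 : - (A i j)%:~R *: al i + 2 *: al j != 0.
    apply/eqP => /(congr1 (fun x => rc x j)).
    rewrite rootcoefD !rootcoefZ !(rootcoef_alpha HA) rootcoef0 eqxx.
    by rewrite eq_sym (negbTE ij) mulr0 mulr1 add0r => /eqP; rewrite pnatr_eq0.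
  have := wform_gt0 HA x0.
  rewrite !(wformDl, wformZl, wformDr HA, wformZr HA) !(wform_alphal HA) !alphaE !H2.
  set a := (A i j)%:~R in hs *; set b := (A j i)%:~R in hs * => h.
  rewrite -(ltr_int R) intrM -/a -/b.
  have -> : 4%:~R = 4%:R :> R by [].
  rewrite -(ltr_pM2l hj); nra.
have eq0 : (A i j == 0) = (A j i == 0).
  apply/eqP/eqP => h0; rewrite h0 mulr0 in hs; apply/eqP; rewrite -(intr_eq0 R).
    by move/esym/eqP: hs; rewrite mulf_eq0 gt_eqF.
  by move/eqP: hs; rewrite mulf_eq0 gt_eqF.
move: lt4 eq0 Ha Hb; move: (A i j) (A j i) => a b h4 h0 ha hb.
have [a0|a0] := eqVneq a 0; first by move: h0; rewrite a0 eqxx => /esym/eqP ->.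
have b0 : b != 0 by rewrite -h0.
have {ha hb a0 b0 h0} [ha hb] : a <= -1 /\ b <= -1 by lia.
have : -3 <= a by nia.
have : -3 <= b by nia.
move=> hb' ha'.
move: h4; have [->|[->|->]] : a = -1 \/ a = -2 \/ a = -3 by lia.
all: by have [->|[->|->]] : b = -1 \/ b = -2 \/ b = -3 by lia.
Qed.


(** A word in s_i and s_j moves [x] only by a combination of the two simple roots. Following the two
    coefficients turns a braid relation into polynomial identities. *)
Lemma sref_rank2 i j x (p q : R) : i != j ->
  sr i *m (x + (p *: al i + q *: al j))
  = x + ((- p - q * (A i j)%:~R - x i 0) *: al i + q *: al j).
Proof.
case: (HA) => H2 _ _ _ _ _; rewrite srefE !mxE H2 -addrA; congr (x + _).
rewrite addrAC -scalerBl; congr (_ *: _ + _).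
by rewrite (_ : 2%:~R = 2%:R) //; ring.
Qed.

Lemma rank2_braid i j : i != j -> exists m,
  [/\ (0 < m)%N, W (altword i j m) = W (altword j i m)
    & forall k, (k < m)%N -> exists p q, [/\ 0 <= p, 0 <= q
        & W (altword i j k) *m al i = p *: al i + q *: al j]].
Proof.
move=> ij; have ji : j != i by rewrite eq_sym.
have Ei x (p q : R) := sref_rank2 x p q ij.
have Ej x (p q : R) :
    sr j *m (x + (p *: al i + q *: al j))
    = x + (p *: al i + (- q - p * (A j i)%:~R - x j 0) *: al j).
  by rewrite [_ + q *: _ in LHS]addrC (sref_rank2 x q p ji) [X in x + X]addrC.
have E0 x : x = x + (0 *: al i + 0 *: al j) by rewrite !scale0r !addr0.
have E1 : al i = 0 + (1 *: al i + 0 *: al j) by rewrite scale0r scale1r addr0 add0r.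
have eqW s t : (forall x, W s *m x = W t *m x) -> W s = W t.
  move=> H; apply/matrixP => k l; have /colP/(_ k) := H (delta_mx l 0).
  by rewrite -!colE [LHS]mxE [RHS]mxE.
have H0 k : (0 : 'cV[R]_n) k 0 = 0 by rewrite mxE.
have [[a b] [Hab Ha Hb]] := rank2_cases ij.
move: Hab; rewrite !inE => Hab; move: Ei Ej; rewrite Ha Hb /= => Ei Ej.
have braid s t p q p' q' :
    (forall x, W s *m (x + (0 *: al i + 0 *: al j)) = x + (p x *: al i + q x *: al j)) ->
    (forall x, W t *m (x + (0 *: al i + 0 *: al j)) = x + (p' x *: al i + q' x *: al j)) ->
    (forall x, p x = p' x /\ q x = q' x) -> W s = W t.
  by move=> Hs Ht Hpq; apply: eqW => x; rewrite (E0 x) Hs Ht !(Hpq x).1 !(Hpq x).2.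
repeat case/orP: Hab => Hab; case/eqP: Hab Ei Ej => -> -> Ei Ej;
  [exists 2%N | exists 3%N | exists 4%N | exists 4%N | exists 6%N | exists 6%N].
all: split; [by [] | |].
all: try by apply: braid => [x|x|x]; first
  [by rewrite /= -!mulmxA !mul1mx;
  do ?[rewrite Ei | rewrite Ej]; reflexivity | split; ring].
all: (do 6?[case=> [|]]); try discriminate; move=> _; rewrite {1}E1 /= -?mulmxA ?mul1mx;
  do ?[rewrite Ei | rewrite Ej]; rewrite ?H0 add0r.
all: do 2!eexists; split; [| |reflexivity]; lra.
Qed.

(* Deodhar: split off from the right a maximal alternating word in [i] and the
   last letter [j] of a reduced word, and conclude in rank 2. *)
Lemma word_length_pos s i : (len s <= len (rcons s i))%N -> pos_vec A (W s *m al i).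
Proof.
have [N] := ubnP (len s); elim: N s i => // N IH s i HN Hs.
have [t Ht St] := word_length_reduced R A s.
case/lastP: t Ht St => [Ht _|u j Ht St].
  by rewrite -Ht mul1mx => k; rewrite (rootcoef_alpha HA) ler0n.
have Hu : len s = (len u).+1.
  apply/eqP; rewrite eqn_leq; apply/andP; split.
    by rewrite -(word_length_eq Ht) -cats1 -addn1 word_length_cat.
  by rewrite -St size_rcons ltnS word_length_le.
have ij : i != j.
  apply/eqP => eij; move: Hs; rewrite leqNgt => /negP; apply.
  rewrite (@word_length_eq _ _ _ (rcons s i) u) ?Hu // wordmx_rcons -Ht -eij.
  by rewrite -wordmx_rcons -cats1 wordmx_cancel cats0.
have [v [k [Wv Lv Hi Hj]]] : exists v k,
    [/\ W s = W (v ++ altword i j k.+1), len s = (len v + k.+1)%N,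
    (len v <= len (rcons v i))%N & (len v <= len (rcons v j))%N].
  by apply: altword_factor; exists u, 0%N; rewrite addn1 cats1.
have [m [m0 Hm Hk]] := rank2_braid ij.
(* Otherwise the braid relation rewrites the end of the word so that its last letter is [i];
   appending [i] would then shorten [s]. *)
have km : (k.+1 < m)%N.
  rewrite ltnNge; apply/negP => mk.
  have [t Ht' St'] := altword_suffix i j mk.
  case: m m0 Hm Hk mk Ht' St' => // m _ Hm _ mk Ht' St'.
  suff : (len (rcons s i) <= len v + k)%N by lia.
  have -> : k = size (t ++ altword i j m) by rewrite size_cat size_altword St'; lia.
  apply: leq_trans (word_length_cat _ _).
  rewrite (@word_length_eq _ _ _ (rcons s i) (v ++ (t ++ altword i j m))) //.
  rewrite wordmx_rcons Wv Ht' !wordmx_cat Hm -!wordmx_cat -wordmx_rcons.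
  rewrite altword_rcons -!rcons_cat -cats1 wordmx_cancel cats0.
  by [].
have [p [q [p0 q0 Hpq]]] := Hk _ km.
have Pi : pos_vec A (W v *m al i) by apply: IH => //; lia.
have Pj : pos_vec A (W v *m al j) by apply: IH => //; lia.
move=> l; rewrite Wv wordmx_cat -mulmxA Hpq mulmxDr -!scalemxAr.
by rewrite rootcoefD !rootcoefZ addr_ge0 // mulr_ge0.
Qed.

Lemma root_dichotomy s i :
  pos_vec A (W s *m al i) \/ pos_vec A (- (W s *m al i)).
Proof.
have [H|H] := leqP (len s) (len (rcons s i)); first by left; apply: word_length_pos.
right; rewrite -mulmxN -(sref_alpha HA) mulmxA -wordmx_rcons.
apply: word_length_pos; apply: leq_trans (ltnW H) _.
by rewrite (@word_length_eq _ _ _ (rcons (rcons s i) i) s) // 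
   -[rcons (rcons s i) i]cats1 wordmx_cancel cats0.
Qed.

End Positivity.

(** * Finiteness of the Weyl group, the longest element *)

Definition is_root (R : realType) (n : nat) (A : 'M[int]_n) (x : 'cV[R]_n) : Prop :=
  exists s i, x = wordmx R A s *m alpha R A i.

Definition pos_root (R : realType) (n : nat) (A : 'M[int]_n) (x : 'cV[R]_n) : Prop :=
  is_root A x /\ pos_vec A x.

Definition dominant (R : realType) (n : nat) (x : 'cV[R]_n) : Prop :=
  forall i, 0 <= x i 0.

Section Roots.
Variables (R : realType) (n : nat) (A : 'M[int]_n) (d : 'I_n -> R).
Hypothesis HA : cartan_datum A d.
Local Notation om := (@omega R n).
Local Notation al := (@alpha R n A).
Local Notation sr := (@sref R n A).
Local Notation W := (@wordmx R n A).
Local Notation rc := (@rootcoef R n A).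
Local Notation B := (wform A d).
Local Notation len := (@word_length R n A).
Implicit Types (x y : 'cV[R]_n) (s t : seq 'I_n) (i j : 'I_n).

Lemma wordmx_int s x : (forall j, x j 0 \is a Num.int) ->
  forall j, (W s *m x) j 0 \is a Num.int.
Proof.
move=> Hx; elim: s => [|i s IH] j; first by rewrite mul1mx.
rewrite -mulmxA srefE !mxE; apply: rpredB; first by have := IH j; rewrite mxE.
by apply: rpredM; [have := IH i; rewrite mxE | apply: intr_int].
Qed.

Lemma root_rootcoef_int x : is_root A x -> forall j, rc x j \is a Num.int.
Proof.
move=> [s [i ->]]; elim: s => [|k s IH] j.
  by rewrite mul1mx (rootcoef_alpha HA); case: eqP => _; rewrite ?rpred0 ?rpred1.
rewrite -mulmxA (rootcoef_sref HA); apply: rpredB => //; apply: rpredM.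
  by apply: wordmx_int => l; rewrite alphaE intr_int.
by case: eqP => _; rewrite ?rpred0 ?rpred1.
Qed.

Lemma is_root_wordmx s x : is_root A x -> is_root A (W s *m x).
Proof. by move=> [t [i ->]]; exists (s ++ t), i; rewrite wordmx_cat mulmxA. Qed.

Lemma is_root_alpha i : is_root A (al i).
Proof. by exists [::], i; rewrite mul1mx. Qed.

Lemma pos_root_alpha i : pos_root A (al i).
Proof.
by split=> [|j]; [apply: is_root_alpha | rewrite (rootcoef_alpha HA) ler0n].
Qed.

Lemma root_pos_or_neg x : is_root A x -> pos_vec A x \/ pos_vec A (- x).
Proof. by move=> [s [i ->]]; apply: (root_dichotomy HA). Qed.

Lemma root_neq0 x : is_root A x -> x != 0.
Proof.
move=> [s [i ->]]; apply/eqP => /(congr1 (mulmx (W (rev s)))).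
rewrite (wordmxK HA) mulmx0 => /(congr1 (fun y => rc y i)).
by rewrite (rootcoef_alpha HA) rootcoef0 eqxx => /eqP; rewrite oner_eq0.
Qed.

Lemma pos_vec_antisym x : pos_vec A x -> pos_vec A (- x) -> x = 0.
Proof.
move=> Hp Hn; apply: (rootcoef_inj HA) => i; rewrite rootcoef0; apply/le_anti.
by rewrite Hp -oppr_ge0 -rootcoefN Hn.
Qed.

Lemma pos_root_negF x : pos_root A x -> pos_vec A (- x) -> False.
Proof. by move=> [/root_neq0/eqP Hr Hp] Hn; apply: Hr; apply: pos_vec_antisym. Qed.

(** s_i changes only the coefficient of alpha_i, so a positive root made negative is a multiple m
    alpha_i. Both m and 1/m are integers, hence m = 1. *)
Lemma pos_root_sref i x : pos_root A x -> x <> al i -> pos_root A (sr i *m x).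
Proof.
move=> [Hr Hp] Hx; have Hs : is_root A (sr i *m x).
  by rewrite -wordmx1; apply: is_root_wordmx.
split=> //; have [//|Hn] := root_pos_or_neg Hs; case: Hx.
have H0 j : j != i -> rc x j = 0.
  move=> ji; apply/le_anti; rewrite Hp andbT -oppr_ge0 -rootcoefN.
  by have := Hn j; rewrite !rootcoefN (rootcoef_sref HA) (negbTE ji) mulr0 subr0.
have xE : x = rc x i *: al i.
  rewrite {1}(rootcoef_expand HA x) (bigD1 i) //= big1 ?addr0 // => j ji.
  by rewrite H0 // scale0r.
have m0 : rc x i != 0.
  by apply/eqP => m0; move: (root_neq0 Hr); rewrite xE m0 scale0r eqxx.
have Hm := root_rootcoef_int Hr i; have Hm0 := Hp i.
set m := rc x i in xE m0 Hm Hm0.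
have [s [k xs]] := Hr.
(* The inverse of [W s] takes [x] to a simple root, hence takes alpha_i to 1/m times that simple
   root, which is again a root. *)
have Hm' : m^-1 \is a Num.int.
  have -> : m^-1 = rc (W (rev s) *m al i) k.
    have -> : al i = m^-1 *: x by rewrite [in RHS]xE scalerA mulVf // scale1r.
    by rewrite -scalemxAr [in W _ *m _]xs (wordmxK HA) rootcoefZ (rootcoef_alpha HA) eqxx mulr1.
  by apply: root_rootcoef_int; apply: is_root_wordmx; apply: is_root_alpha.
rewrite xE; suff -> : m = 1 by rewrite scale1r.
case/intrP: Hm Hm0 m0 Hm' => a ->; rewrite ler0z intr_eq0 => a0 an0 /intrP [b].
move/(congr1 ( *%R a%:~R)); rewrite divff ?intr_eq0 // -intrM => /eqP.
rewrite -[1](mulr1z (1 : R)) eqr_int => /eqP ab.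
have -> // : a = 1.
have : 0 < b by nia.
nia.
Qed.

Lemma pos_root_wordmx s x : pos_root A x ->
  pos_root A (W s *m x) \/
  exists s1 j s2, s = s1 ++ j :: s2 /\ W s2 *m x = al j.
Proof.
move=> Hx; elim: s => [|i s [IH|[s1 [j [s2 [-> H]]]]]]; first by left; rewrite mul1mx.
  have [E|/eqP E] := eqVneq (W s *m x) (al i).
    by right; exists [::], i, s.
  by left; rewrite /= -mulmxA; apply: pos_root_sref.
by right; exists (i :: s1), j, s2.
Qed.

Lemma wform_pos_dominant x y : pos_vec A x -> dominant y -> 0 <= B x y.
Proof.
case: (HA) => _ _ Hd _ _ Hx Hy; apply: sumr_ge0 => i _.
by rewrite !mulr_ge0 // ltW.
Qed.

Lemma word_length_rcons_ex s : (0 < len s)%N ->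
  exists u i, W s = W (rcons u i) /\ len s = (len u).+1.
Proof.
move=> s0; have [t Ht St] := word_length_reduced R A s.
case/lastP: t Ht St => [Ht St|u i Ht St]; first by rewrite -St in s0.
exists u, i; split=> //; apply/eqP; rewrite eqn_leq; apply/andP; split.
  by rewrite -(word_length_eq Ht) -cats1 -addn1 word_length_cat.
by rewrite -St size_rcons ltnS word_length_le.
Qed.

(** Write w = u s_i with u shorter. The root w alpha_i is negative and w x is dominant, so their
    pairing d_i x_i is at most 0. Hence x_i = 0, s_i fixes [x], and w can be replaced by u. *)
Lemma dominant_orbit s x : dominant x -> dominant (W s *m x) -> W s *m x = x.
Proof.
case: (HA) => _ _ Hd _ _.
move=> Hx; have [N] := ubnP (len s); elim: N s => // N IH s HN Hs.
have [l0|] := posnP (len s).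
  have [t Ht] := word_length_reduced R A s; rewrite l0 => /size0nil t0.
  by rewrite -Ht t0 mul1mx.
move=> /word_length_rcons_ex [u [i [Wu Lu]]].
have Hui : pos_vec A (W u *m al i).
  by apply: (word_length_pos HA); rewrite -(word_length_eq Wu) Lu.
have Bx : B (W s *m al i) (W s *m x) = d i * x i 0.
  by rewrite (wform_wordmx HA) (wform_alphal HA).
have Wn : W s *m al i = - (W u *m al i).
  by rewrite Wu wordmx_rcons -mulmxA (sref_alpha HA) mulmxN.
have x0 : x i 0 = 0.
  apply/le_anti; rewrite Hx andbT -(pmulr_rle0 _ (Hd i)) -Bx Wn wformNl oppr_le0.
  exact: wform_pos_dominant.
have Hsx : W s *m x = W u *m x.
  by rewrite Wu wordmx_rcons -mulmxA srefE x0 scale0r subr0.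
by rewrite Hsx IH -?Hsx // -ltnS -Lu.
Qed.

Lemma wform_bound x y : `|B x y| <= (B x x + B y y) / 2.
Proof.
have h1 := wform_ge0 HA (x + y); have h2 := wform_ge0 HA (x - y).
move: h1 h2; rewrite !(wformDl, wformNl, wformDr HA, wformNr HA) (wformC HA y x).
rewrite ler_norml => h1 h2; apply/andP; split; lra.
Qed.

(** This is finiteness of W. In the basis of fundamental weights the entries of [W s] are integers,
    and d_i times an entry is the pairing of alpha_i with w omega_j, bounded because w preserves
    norms. Shifting by the bound [K] lands in a finite type. *)
Lemma wordmx_encode : exists (T : finType) (f : seq 'I_n -> T),
  forall s t, f s = f t -> W s = W t.
Proof.
case: (HA) => _ _ Hd _ _.
pose M (p : 'I_n * 'I_n) := (B (al p.1) (al p.1) + B (om p.2) (om p.2)) / 2 / d p.1.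
pose K := \max_p Num.bound (M p).
have HM s i j : `|W s i j| <= K%:R.
  have -> : W s i j = (W s *m om j) i 0 by rewrite -colE mxE.
  apply: le_trans (_ : M (i, j) <= _).
    rewrite /M /= ler_pdivlMr // mulrC -(wform_wordmx HA s (om j)).
    rewrite -{1}(gtr0_norm (Hd i)) -normrM -(wform_alphal HA).
    exact: wform_bound.
  have M0 : 0 <= M (i, j).
    by rewrite divr_ge0 ?(ltW (Hd _)) // divr_ge0 // addr_ge0 ?(wform_ge0 HA).
  apply: le_trans (ltW (archi_boundP M0)) _.
  by rewrite ler_nat (leq_bigmax (i, j)).
have Hint s i j : W s i j \is a Num.int.
  have -> : W s i j = (W s *m om j) i 0 by rewrite -colE mxE.
  by apply: wordmx_int => k; rewrite omegaE; case: eqP; rewrite ?rpred0 ?rpred1.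
pose f s := [ffun p : 'I_n * 'I_n =>
  inord (absz (Num.floor (W s p.1 p.2) + K%:Z)) : 'I_(K + K).+1].
exists _, f => s t /ffunP H; apply/matrixP => i j.
have {H} := congr1 val (H (i, j)); rewrite !ffunE /=.
have := HM s i j; have := HM t i j.
rewrite -(floorK (Hint s i j)) -(floorK (Hint t i j)).
move: (Num.floor (W s i j)) (Num.floor (W t i j)) => a b.
rewrite !intrKfloor !pmulrn -!intr_norm !ler_int => hb ha.
rewrite !inordK; try lia.
by move=> hab; congr (_%:~R); lia.
Qed.

(** If two prefixes of a reduced word gave the same element, the letters between them could be
    removed. The number of codes therefore bounds the length. *)
Lemma reduced_size_inj (T : Type) (f : seq 'I_n -> T) s :
  (forall s t, f s = f t -> W s = W t) -> size s = len s ->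
  injective (fun k : 'I_(size s).+1 => f (take k s)).
Proof.
move=> Hf Hs.
suff H (k l : 'I_(size s).+1) : f (take k s) = f (take l s) -> (l <= k)%N.
  by move=> k l Hkl; apply/val_inj/anti_leq/andP; split; apply: H.
move=> /Hf Hkl; rewrite leqNgt; apply/negP => kl.
have := @word_length_le R n A s (take k s ++ drop l s).
rewrite wordmx_cat Hkl -wordmx_cat cat_take_drop size_cat size_take size_drop -Hs.
move/(_ erefl); have := ltn_ord k; have := ltn_ord l; case: ifP; lia.
Qed.

Lemma word_length_bounded : exists N, forall s, (len s <= N)%N.
Proof.
have [T [f Hf]] := wordmx_encode; exists #|T| => s.
have [t Ht St] := word_length_reduced R A s; rewrite (word_length_eq (esym Ht)) in St *.
have := leq_card _ (reduced_size_inj Hf St); rewrite card_ord St; lia.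
Qed.

(** At maximal length no letter can lengthen the word, so every simple root becomes negative. This
    property is what later identifies the involution on vertices. *)
Lemma longest_ex : exists s, longest A (W s) /\ forall i, pos_vec A (- (W s *m al i)).
Proof.
have [N HN] := word_length_bounded.
have [s Hs] : exists s, forall t, (len t <= len s)%N.
  suff H k : forall s, (N - len s <= k)%N -> exists s, forall t, (len t <= len s)%N.
    exact: (H N [::] (leq_subr _ _)).
  elim: k => [|k IH] s Hk.
    by exists s => t; have := HN t; have := HN s; lia.
  have [[t Ht]|H] := EM (exists t, (len s < len t)%N).
    by apply: (IH t); have := HN t; lia.
  by exists s => t; rewrite leqNgt; apply/negP => Ht; apply: H; exists t.
have [u Hu Su] := word_length_reduced R A s.
exists s; split=> [|i].
  exists u; split=> //; split=> [t Ht|t].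
    by rewrite Su word_length_le.
  have [t' Ht' St'] := word_length_reduced R A t; exists t'; split=> //.
  by rewrite St' Su.
rewrite -mulmxN -(sref_alpha HA) mulmxA -wordmx_rcons.
apply: (word_length_pos HA); apply: leq_trans (Hs _) _.
by rewrite (@word_length_eq _ _ _ (rcons (rcons s i) i) s) //
   -[rcons (rcons s i) i]cats1 (wordmx_cancel HA) cats0.
Qed.

Lemma wordmx_cpow s k : exists t, forall x, W t *m x = cpow (W s) k x.
Proof.
elim: k => [|k [t Ht]]; first by exists [::] => x; rewrite mul1mx.
by exists (s ++ t) => x; rewrite wordmx_cat -mulmxA Ht.
Qed.

Lemma wordmx_order s : exists2 N, (0 < N)%N & forall x, cpow (W s) N x = x.
Proof.
have [T [f Hf]] := wordmx_encode.
have [t Ht] := choice (wordmx_cpow s).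
have : ~~ injectiveb (fun k : 'I_#|T|.+1 => f (t k)).
  apply/negP => /injectiveP Hi; have := leq_card _ Hi.
  by rewrite card_ord ltnn.
move=> /injectivePn [k [l kl /Hf Hkl]].
have H (a b : nat) : (a < b)%N -> W (t a) = W (t b) ->
    exists2 N, (0 < N)%N & forall x, cpow (W s) N x = x.
  move=> ab Hab; exists (b - a)%N => [|x]; first by rewrite subn_gt0.
  apply: (@wordmx_inj _ _ _ _ HA (t a)).
  by rewrite [in RHS]Hab !Ht /cpow -iterD subnKC // ltnW.
have [kl'|kl'|/val_inj E] := ltngtP k l.
- exact: H kl' Hkl.
- exact: H kl' (esym Hkl).
- by rewrite E eqxx in kl.
Qed.

End Roots.

(** * Mutation at a source *)

Definition is_omega (R : realType) (n : nat) (x : 'cV[R]_n) : bool :=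
  [exists i, x == omega R i].

(* [(c^-1 - 1) x] for [c = wordmx s]. *)
Definition coxdiff (R : realType) (n : nat) (A : 'M[int]_n) (s : seq 'I_n)
  (x : 'cV[R]_n) : 'cV[R]_n := wordmx R A (rev s) *m x - x.

(* The weights in [Pi(c)], without reference to orbits. *)
Definition coxPi (R : realType) (n : nat) (A : 'M[int]_n) (s : seq 'I_n)
  (x : 'cV[R]_n) : Prop := is_omega x \/ pos_root A (coxdiff A s x).

(** For fundamental [x] and a Coxeter word, [coxdiff] is a negative root; the degree then comes
    entirely from the other term of [sym_degree]. *)
Definition half_degree (R : realType) (n : nat) (A : 'M[int]_n) (d : 'I_n -> R)
  (s : seq 'I_n) (x y : 'cV[R]_n) : R :=
  if is_omega x then 0 else Num.max 0 (wform A d (coxdiff A s x) y).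

(* The compatibility degree times half the squared length of the root attached
   to [x]; this makes it symmetric. *)
Definition sym_degree (R : realType) (n : nat) (A : 'M[int]_n) (d : 'I_n -> R)
  (s : seq 'I_n) (x y : 'cV[R]_n) : R :=
  Num.max (half_degree A d s x y) (half_degree A d s y x).

(* On [Pi(c)] this is [s_i], except that [omega_i] goes to [- omega_i]. *)
Definition mutation (R : realType) (n : nat) (A : 'M[int]_n) (i : 'I_n)
  (x : 'cV[R]_n) : 'cV[R]_n :=
  if x i 0 <= 0 then sref R A i *m x else x - (2 * x i 0) *: omega R i.

Definition mutationV (R : realType) (n : nat) (A : 'M[int]_n) (i : 'I_n)
  (x : 'cV[R]_n) : 'cV[R]_n :=
  if 0 <= x i 0 then sref R A i *m x else x - (2 * x i 0) *: omega R i.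

Definition coxword (n : nat) (s : seq 'I_n) := perm_eq s (enum 'I_n).

Section Mutation.
Variables (R : realType) (n : nat) (A : 'M[int]_n) (d : 'I_n -> R).
Hypothesis HA : cartan_datum A d.
Local Notation om := (@omega R n).
Local Notation al := (@alpha R n A).
Local Notation sr := (@sref R n A).
Local Notation W := (@wordmx R n A).
Local Notation rc := (@rootcoef R n A).
Local Notation cd := (@coxdiff R n A).
Local Notation mut := (@mutation R n A).
Local Notation mutV := (@mutationV R n A).
Local Notation G := (@sym_degree R n A d).
Local Notation H := (@half_degree R n A d).
Implicit Types (x y : 'cV[R]_n) (s t : seq 'I_n) (i j : 'I_n).

Lemma coxword_uniq s : coxword s -> uniq s.
Proof. by move=> hs; rewrite (perm_uniq hs) enum_uniq. Qed.

Lemma coxword_mem s i : coxword s -> i \in s.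
Proof. by move=> hs; rewrite (perm_mem hs) mem_enum. Qed.

Lemma coxword_rot s i : coxword (i :: s) -> coxword (rcons s i).
Proof. by apply: perm_trans; rewrite perm_rcons. Qed.

Lemma coxword_notin s i : coxword (i :: s) -> i \notin s.
Proof. by move=> /coxword_uniq /= /andP []. Qed.

Lemma coxword_split s j : coxword s ->
  exists s1 s2, [/\ s = s1 ++ j :: s2, j \notin s1 & j \notin s2].
Proof.
move=> hs; have hj := coxword_mem j hs; have hu := coxword_uniq hs.
case/splitPr: hj hs hu => s1 s2 hs; rewrite cat_uniq /= => /and3P [_ H1 /andP [H2 _]].
by exists s1, s2; split=> //; apply: contra H1 => ->.
Qed.

Lemma wordmx_fixed s x : uniq s -> W s *m x = x -> forall i, i \in s -> x i 0 = 0.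
Proof.
elim: s => // i s IH /andP [/= Hi Hu] Hx.
have Hsx : W s *m x = sr i *m x by rewrite -[in RHS]Hx -mulmxA (srefK HA).
have xi0 : x i 0 = 0.
  have := congr1 (fun y => rc y i) Hsx.
  rewrite (rootcoef_wordmx_notin HA) // (rootcoef_sref HA) eqxx mulr1.
  by move/eqP; rewrite eq_sym addrC -subr_eq0 addrK oppr_eq0 => /eqP.
move=> j; rewrite inE => /predU1P [-> //|]; apply: IH => //.
by rewrite Hsx srefE xi0 scale0r subr0.
Qed.

Lemma coxdiffB s x y : cd s (x - y) = cd s x - cd s y.
Proof. by rewrite /coxdiff mulmxBr [in LHS]opprD opprK addrACA opprB [y - _]addrC. Qed.

Lemma coxdiffN s x : cd s (- x) = - cd s x.
Proof. by rewrite /coxdiff mulmxN opprB addrC opprK. Qed.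

Lemma coxdiff_inj s x y : coxword s -> cd s x = cd s y -> x = y.
Proof.
move=> hs Hxy; apply/eqP; rewrite -subr_eq0; apply/eqP/colP => i; rewrite [RHS]mxE.
apply: (@wordmx_fixed (rev s)).
- by rewrite rev_uniq coxword_uniq.
- by apply/eqP; rewrite -subr_eq0 -/(cd s (x - y)) coxdiffB Hxy subrr.
- by rewrite mem_rev coxword_mem.
Qed.

(** The letter i occurs once in c^-1 and acts before all others, so it sees the original coordinate
    of [x]. Membership in Pi(c) thereby fixes the sign of the source coordinate. *)
Lemma coxdiff_head i s x : i \notin s -> rc (cd (i :: s) x) i = - x i 0.
Proof.
move=> Hi; rewrite /coxdiff rev_cons wordmx_rcons -mulmxA rootcoefB.
rewrite (rootcoef_wordmx_notin HA) ?mem_rev // (rootcoef_sref HA) eqxx mulr1.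
by rewrite addrAC subrr add0r.
Qed.

Lemma coxdiff_rot i s x : cd (rcons s i) (sr i *m x) = sr i *m cd (i :: s) x.
Proof.
rewrite /coxdiff rev_rcons rev_cons wordmx_cons wordmx_rcons mulmxBr.
by rewrite -!mulmxA.
Qed.

Lemma coxdiff_omega_split s1 j s2 : j \notin s1 -> j \notin s2 ->
  cd (s1 ++ j :: s2) (om j) = - (W (rev s2) *m al j).
Proof.
move=> H1 H2; rewrite /coxdiff rev_cat rev_cons wordmx_cat wordmx_rcons.
rewrite -!mulmxA wordmx_omega_notin ?mem_rev // sref_omega mulmxBr.
by rewrite wordmx_omega_notin ?mem_rev // addrAC subrr add0r.
Qed.

(** The root obtained from alpha_j by letters other than j keeps coefficient 1 at alpha_j, which
    excludes the negative case. *)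
Lemma coxdiff_omega_neg s j : coxword s -> pos_root A (- cd s (om j)).
Proof.
move=> /(coxword_split j) [s1 [s2 [-> H1 H2]]].
rewrite coxdiff_omega_split // opprK.
have Hr : is_root A (W (rev s2) *m al j) by apply/is_root_wordmx/is_root_alpha.
split=> //; have [//|Hn] := root_pos_or_neg HA Hr.
have := Hn j; rewrite rootcoefN (rootcoef_wordmx_notin HA) ?mem_rev //.
by rewrite (rootcoef_alpha HA) eqxx ler0N1.
Qed.

Lemma omegaP x : reflect (exists i, x = om i) (is_omega x).
Proof. by apply: (iffP existsP) => -[i]; [move/eqP|] => ->; exists i. Qed.

Lemma is_omega_omega i : is_omega (om i).
Proof. by apply/omegaP; exists i. Qed.

Lemma opp_omega_omegaF i : ~~ is_omega (- om i).
Proof.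
apply/omegaP => -[j /colP /(_ i)]; rewrite mxE !omegaE eqxx => E.
by have := ler0n R (i == j); rewrite -E ler0N1.
Qed.

Lemma coxPi_root s x : coxPi A s x -> ~~ is_omega x -> pos_root A (cd s x).
Proof. by case=> // ->. Qed.

Lemma coxPi_omegaF s x : coxword s -> pos_root A (cd s x) -> ~~ is_omega x.
Proof.
move=> hs Hp; apply/omegaP => -[j xj]; apply: (pos_root_negF HA Hp).
by rewrite xj; case: (coxdiff_omega_neg j hs).
Qed.

Lemma coxPi_neq0 s x : coxPi A s x -> x != 0.
Proof.
case=> [/omegaP [i ->]|[/(root_neq0 HA) Hr _]]; first exact: omega_eq0.
by apply: contra Hr => /eqP ->; rewrite /coxdiff mulmx0 subrr.
Qed.

Lemma coxPi_head_le0 i s x : i \notin s -> coxPi A (i :: s) x -> x <> om i ->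
  x i 0 <= 0.
Proof.
move=> Hi [/omegaP [j ->] ne|[_ Hp] _].
  by rewrite omegaE; case: eqP => // ij; case: ne; rewrite ij.
by rewrite -oppr_ge0 -(coxdiff_head _ Hi).
Qed.

Lemma mutation_le0 i x : x i 0 <= 0 -> mut i x = sr i *m x.
Proof. by rewrite /mutation => ->. Qed.

Lemma mutation_omega i : mut i (om i) = - om i.
Proof.
rewrite /mutation omegaE eqxx ler10 mulr1 scaler_nat mulr2n opprD addrA.
by rewrite subrr add0r.
Qed.

Lemma mutation_coord i x : mut i x i 0 = - x i 0.
Proof.
rewrite /mutation; case: ifP => _; first exact: (sref_coord HA).
by rewrite !mxE !eqxx mulr1; ring.
Qed.

Lemma mutationV_coord i x : mutV i x i 0 = - x i 0.
Proof.
rewrite /mutationV; case: ifP => _; first exact: (sref_coord HA).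
by rewrite !mxE !eqxx mulr1; ring.
Qed.

Lemma mutationK i : cancel (mut i) (mutV i).
Proof.
move=> x; rewrite /mutationV mutation_coord oppr_ge0 /mutation.
case: (x i 0 <= 0); first exact: (srefK HA).
by rewrite mulrN scaleNr opprK subrK.
Qed.

Lemma mutationVK i : cancel (mutV i) (mut i).
Proof.
move=> x; rewrite /mutation mutationV_coord oppr_le0 /mutationV.
case: (0 <= x i 0); first exact: (srefK HA).
by rewrite mulrN scaleNr opprK subrK.
Qed.

(** The failure of linearity is isolated in one scalar, so linearity on a cone reduces to additivity
    of a positive part. *)
Lemma mutationE i x :
  mut i x = sr i *m x + Num.max 0 (x i 0) *: (al i - 2 *: om i).
Proof.
rewrite /mutation srefE; case: leP => Hx; first by rewrite scale0r addr0.
by rewrite scalerBr scalerA addrA subrK mulrC.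
Qed.

Lemma coxdiff_sref_omega i s : i \notin s -> cd (i :: s) (sr i *m om i) = al i.
Proof.
move=> Hi; rewrite /coxdiff rev_cons wordmx_rcons -mulmxA (srefK HA).
by rewrite wordmx_omega_notin ?mem_rev // sref_omega subKr.
Qed.

Lemma coxdiff_opp_omega i s : i \notin s -> cd (rcons s i) (- om i) = al i.
Proof.
move=> Hi; rewrite coxdiffN /coxdiff rev_rcons wordmx_cons -mulmxA.
by rewrite wordmx_omega_notin ?mem_rev // sref_omega addrAC subrr add0r opprK.
Qed.

Lemma mutation_cases i s x : coxword (i :: s) -> coxPi A (i :: s) x ->
  x = om i \/ x i 0 <= 0 /\ mut i x = sr i *m x.
Proof.
move=> hs Hx; have [->|/eqP ne] := eqVneq x (om i); first by left.
right; have H0 := coxPi_head_le0 (coxword_notin hs) Hx ne.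
by rewrite mutation_le0.
Qed.

(** s_i permutes the positive roots other than alpha_i. The weight s_i omega_i, whose root is
    alpha_i, becomes omega_i; in exchange omega_i becomes - omega_i, whose root for the rotated word
    is alpha_i. *)
Lemma coxPi_mutation i s x : coxword (i :: s) -> coxPi A (i :: s) x ->
  coxPi A (rcons s i) (mut i x).
Proof.
move=> hs; have Hi := coxword_notin hs.
move=> Hx; have [->|[H0 ->]] := mutation_cases hs Hx.
  right; rewrite mutation_omega coxdiff_opp_omega //.
  exact: (pos_root_alpha HA).
case: Hx => [/omegaP [j xj]|Hp].
  have [ij|ij] := eqVneq i j.
    by move: H0; rewrite xj ij omegaE eqxx ler10.
  by left; rewrite xj sref_omega_neq // is_omega_omega.
have [E|/eqP E] := eqVneq (cd (i :: s) x) (al i).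
  left; rewrite (@coxdiff_inj (i :: s) x (sr i *m om i) hs).
    by rewrite (srefK HA) is_omega_omega.
  by rewrite E coxdiff_sref_omega.
by right; rewrite coxdiff_rot; apply: (pos_root_sref HA).
Qed.

Lemma coxPi_mutationV i s x : coxword (i :: s) -> coxPi A (rcons s i) x ->
  coxPi A (i :: s) (mutV i x).
Proof.
move=> hs; have Hi := coxword_notin hs.
case=> [/omegaP [j ->]|Hp].
  have [<-|ij] := eqVneq i j.
    right; rewrite /mutationV omegaE eqxx ler01 coxdiff_sref_omega //.
    exact: (pos_root_alpha HA).
  rewrite /mutationV omegaE (negbTE ij) lexx sref_omega_neq //.
  by left; rewrite is_omega_omega.
have [E|/eqP E] := eqVneq (cd (rcons s i) x) (al i).
  left; have -> : x = - om i.
    by apply: (coxdiff_inj (coxword_rot hs)); rewrite E coxdiff_opp_omega.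
  by rewrite -mutation_omega mutationK is_omega_omega.
have Hp' : pos_root A (cd (i :: s) (sr i *m x)).
  suff -> : cd (i :: s) (sr i *m x) = sr i *m cd (rcons s i) x.
    exact: (pos_root_sref HA).
  by rewrite -[in RHS](srefK HA i x) coxdiff_rot (srefK HA).
have H0 : 0 <= x i 0.
  have := proj2 Hp' i; rewrite coxdiff_head // (sref_coord HA).
  by rewrite opprK.
by right; rewrite /mutationV H0.
Qed.

Lemma sym_degreeC s x y : G s x y = G s y x.
Proof. exact: maxC. Qed.

Lemma half_degree_ge0 s x y : 0 <= H s x y.
Proof. by rewrite /half_degree; case: ifP => // _; rewrite le_max lexx. Qed.

Lemma half_degree_omegar i s x : i \notin s -> coxPi A (i :: s) x -> x <> om i ->
  H (i :: s) x (om i) = - (d i * x i 0).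
Proof.
case: (HA) => _ _ Hd _ _ Hi Hx ne; have H0 := coxPi_head_le0 Hi Hx ne.
rewrite /half_degree; case: ifP => Ho.
  case/omegaP: Ho ne => j -> ne.
  by rewrite omegaE; case: eqP => [ij|_]; [case: ne; rewrite ij | rewrite mulr0 oppr0].
rewrite (wform_omegar) coxdiff_head // mulrN; apply/max_idPr.
by rewrite oppr_ge0 pmulr_rle0.
Qed.

Lemma half_degree_omegal i s x : H s (om i) x = 0.
Proof. by rewrite /half_degree is_omega_omega. Qed.

Lemma sym_degree_omega i s x : i \notin s -> coxPi A (i :: s) x -> x <> om i ->
  G (i :: s) x (om i) = - (d i * x i 0).
Proof.
case: (HA) => _ _ Hd _ _ Hi Hx ne.
rewrite /sym_degree half_degree_omegal half_degree_omegar //.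
by apply/max_idPl; rewrite oppr_ge0 pmulr_rle0 // (coxPi_head_le0 Hi Hx).
Qed.

Lemma half_degree_sref i s x y : coxword (i :: s) -> coxPi A (i :: s) x ->
  x <> om i -> y i 0 <= 0 ->
  H (rcons s i) (sr i *m x) (sr i *m y) = H (i :: s) x y.
Proof.
case: (HA) => _ _ Hd _ _.
move=> hs Hx ne Hy; have Hi := coxword_notin hs.
rewrite /half_degree coxdiff_rot (wform_sref HA).
have [Ho|Ho] := boolP (is_omega x).
  case/omegaP: Ho ne => j -> ne; rewrite sref_omega_neq ?is_omega_omega //.
  by apply/eqP => ij; case: ne; rewrite ij.
(* The reflected weight may become fundamental, which drops the left term. Then the root of [x] is
   alpha_i, and the right term is already 0 because y_i is at most 0. *)
case: ifP => // /omegaP [j xj].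
have xE : x = sr i *m om j by rewrite -xj (srefK HA).
have [ij|ij] := eqVneq i j; last first.
  by move: Ho; rewrite xE sref_omega_neq // is_omega_omega.
rewrite xE -ij coxdiff_sref_omega // (wform_alphal HA); apply/esym/max_idPl.
by rewrite pmulr_rle0.
Qed.

(** After mutation the root of - omega_i is alpha_i, and for [y] other than omega_i its pairing with
    the mutated [y] is - d_i y_i, the old degree. The opposite term vanishes, since a positive root
    pairs nonpositively with - omega_i. *)
Lemma sym_degree_mutation_omega i s y : coxword (i :: s) -> coxPi A (i :: s) y ->
  G (rcons s i) (mut i (om i)) (mut i y) = G (i :: s) (om i) y.
Proof.
case: (HA) => _ _ Hd _ _.
move=> hs Hy; have Hi := coxword_notin hs.
have [->|[H0 yE]] := mutation_cases hs Hy.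
  rewrite mutation_omega /sym_degree half_degree_omegal maxxx.
  rewrite /half_degree (negbTE (opp_omega_omegaF i)) coxdiff_opp_omega //.
  rewrite (wform_alphal HA) mxE omegaE eqxx mulrN1 maxxx.
  by apply/max_idPl; rewrite oppr_le0 ltW.
have ne : y <> om i by move=> yi; move: H0; rewrite yi omegaE eqxx ler10.
rewrite [RHS]sym_degreeC sym_degree_omega // /sym_degree.
have Hy' := coxPi_mutation hs Hy.
have -> : H (rcons s i) (mut i y) (mut i (om i)) = 0.
  rewrite /half_degree; case: ifP => // /negbT Ho.
  have [_ Hp] := coxPi_root Hy' Ho.
  rewrite mutation_omega (wformNr HA) wform_omegar; apply/max_idPl.
  by rewrite oppr_le0 mulr_ge0 // ltW.
rewrite {1}/half_degree mutation_omega (negbTE (opp_omega_omegaF i)).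
rewrite coxdiff_opp_omega // (wform_alphal HA) mutation_coord mulrN.
have h : 0 <= - (d i * y i 0) by rewrite oppr_ge0 pmulr_rle0.
by rewrite (max_idPr h); apply/max_idPl.
Qed.

Lemma sym_degree_mutation i s x y : coxword (i :: s) -> coxPi A (i :: s) x ->
  coxPi A (i :: s) y -> G (rcons s i) (mut i x) (mut i y) = G (i :: s) x y.
Proof.
move=> hs Hx Hy.
have [->|[x0 ->]] := mutation_cases hs Hx; first exact: sym_degree_mutation_omega.
have xE := mutation_le0 x0.
have [->|[y0 ->]] := mutation_cases hs Hy.
  by rewrite sym_degreeC -xE sym_degree_mutation_omega // sym_degreeC.
have ne (z : 'cV[R]_n) : z i 0 <= 0 -> z <> om i.
  by move=> z0 zi; move: z0; rewrite zi omegaE eqxx ler10.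
by rewrite /sym_degree !half_degree_sref //; apply: ne.
Qed.

End Mutation.

(** * Uniqueness of expansions *)

Definition compat_set (R : realType) (n : nat) (A : 'M[int]_n) (d : 'I_n -> R)
  (s : seq 'I_n) (S : seq 'cV[R]_n) : Prop :=
  [/\ uniq S, forall y, y \in S -> coxPi A s y
    & forall y z, y \in S -> z \in S -> y != z -> sym_degree A d s y z = 0].

(** The coefficients are a function on all vectors, zero off [S], so that expansions over different
    sets compare pointwise. [S] itself may contain members with coefficient 0. *)
Definition expansion (R : realType) (n : nat) (A : 'M[int]_n) (d : 'I_n -> R)
  (s : seq 'I_n) (x : 'cV[R]_n) (S : seq 'cV[R]_n) (t : 'cV[R]_n -> R) : Prop :=
  [/\ compat_set A d s S, forall y, 0 <= t y, forall y, y \notin S -> t y = 0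
    & x = \sum_(y <- S) t y *: y].

(* After [p] turns of the word, with [x] transported linearly, the coordinate of
   [x] at the source is positive. *)
Fixpoint reach (R : realType) (n : nat) (A : 'M[int]_n) (p : nat) (s : seq 'I_n)
  (x : 'cV[R]_n) : Prop :=
  if s is i :: s' then
    if p is p'.+1 then reach A p' (rcons s' i) (sref R A i *m x) else 0 < x i 0
  else False.

Section Expansions.
Variables (R : realType) (n : nat) (A : 'M[int]_n) (d : 'I_n -> R).
Hypothesis HA : cartan_datum A d.
Local Notation om := (@omega R n).
Local Notation sr := (@sref R n A).
Local Notation W := (@wordmx R n A).
Local Notation B := (wform A d).
Local Notation mut := (@mutation R n A).
Local Notation mutV := (@mutationV R n A).
Implicit Types (x y : 'cV[R]_n) (s : seq 'I_n) (i j : 'I_n).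

Lemma compat_set_coord i s S y : coxword (i :: s) -> compat_set A d (i :: s) S ->
  om i \in S -> y \in S -> y != om i -> y i 0 = 0.
Proof.
case: (HA) => _ _ Hd _ _ hs [_ HP HG] Hi Hy ne.
have /eqP := HG _ _ Hy Hi ne.
rewrite (sym_degree_omega HA (coxword_notin hs) (HP _ Hy)); last exact/eqP.
by rewrite oppr_eq0 mulf_eq0 gt_eqF //= => /eqP.
Qed.

Lemma expansion_max i s x S t : coxword (i :: s) -> expansion A d (i :: s) x S t ->
  \sum_(y <- S) t y * Num.max 0 (y i 0) = t (om i).
Proof.
move=> hs [[HU HP HG] Ht H0 _].
have Hm y : y \in S -> y != om i -> Num.max 0 (y i 0) = 0.
  move=> Hy /eqP ne; apply/max_idPl.
  exact: (coxPi_head_le0 HA (coxword_notin hs) (HP _ Hy)).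
have [Hi|Hi] := boolP (om i \in S); last first.
  rewrite (H0 _ Hi) big1_seq // => y /andP [_ Hy].
  by rewrite Hm ?mulr0 //; apply: contra Hi => /eqP <-.
rewrite (bigD1_seq (om i)) //= big1_seq => [|y /andP [ne Hy]].
  by rewrite addr0 omegaE eqxx (max_idPr ler01) mulr1.
by rewrite Hm // mulr0.
Qed.

(** If omega_i is in [S], compatibility forces the i-th coordinate of the other members to be 0;
    otherwise all members have nonpositive i-th coordinate and so has [x]. *)
Lemma expansion_head i s x S t : coxword (i :: s) -> expansion A d (i :: s) x S t ->
  Num.max 0 (x i 0) = t (om i).
Proof.
move=> hs He; have := He => -[HC Ht H0 xE]; have [HU HP HG] := HC.
have xi : x i 0 = \sum_(y <- S) t y * y i 0.
  by rewrite xE summxE; apply: eq_bigr => y _; rewrite mxE.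
have [Hi|Hi] := boolP (om i \in S); last first.
  rewrite (H0 _ Hi); apply/max_idPl; rewrite xi big_seq; apply: sumr_le0 => y Hy.
  apply: mulr_ge0_le0 => //.
  apply: (coxPi_head_le0 HA (coxword_notin hs) (HP _ Hy)).
  by move=> yi; rewrite -yi Hy in Hi.
have -> : x i 0 = t (om i); last exact/max_idPr.
rewrite xi (bigD1_seq (om i)) //= big1_seq => [|y /andP [ne Hy]].
  by rewrite addr0 omegaE eqxx mulr1.
by rewrite (compat_set_coord hs HC) // mulr0.
Qed.

Lemma compat_set_mutation i s S : coxword (i :: s) -> compat_set A d (i :: s) S ->
  compat_set A d (rcons s i) (map (mut i) S).
Proof.
move=> hs [HU HP HG]; split.
- by rewrite map_inj_uniq //; apply: can_inj (mutationK HA i).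
- by move=> _ /mapP [y Hy ->]; apply: (coxPi_mutation HA) => //; apply: HP.
- move=> _ _ /mapP [y Hy ->] /mapP [z Hz ->].
  rewrite (can_eq (mutationK HA i)) => yz.
  by rewrite (sym_degree_mutation HA) ?HG //; apply: HP.
Qed.

Lemma compat_set_mutationV i s S : coxword (i :: s) -> compat_set A d (rcons s i) S ->
  compat_set A d (i :: s) (map (mutV i) S).
Proof.
move=> hs [HU HP HG].
have HP' y : y \in S -> coxPi A (i :: s) (mutV i y).
  by move=> Hy; apply: (coxPi_mutationV HA) => //; apply: HP.
split.
- by rewrite map_inj_uniq //; apply: can_inj (mutationVK HA i).
- by move=> _ /mapP [y Hy ->]; apply: HP'.
- move=> _ _ /mapP [y Hy ->] /mapP [z Hz ->].
  rewrite (can_eq (mutationVK HA i)) => yz.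
  by rewrite -(sym_degree_mutation HA) ?(mutationVK HA) ?HG //; apply: HP'.
Qed.

(** [expansion_head] and [expansion_max] equate the positive part of x_i with the weighted sum of
    those of the members, so the correction term of [mutationE] distributes over the sum. *)
Lemma expansion_mutation i s x S t : coxword (i :: s) -> expansion A d (i :: s) x S t ->
  expansion A d (rcons s i) (mut i x) (map (mut i) S) (t \o mutV i).
Proof.
move=> hs He; have := He => -[HC Ht H0 xE]; split=> [|y|y Hy|].
- exact: compat_set_mutation.
- exact: Ht.
- apply: H0; apply: contra Hy => Hy; apply/mapP; exists (mutV i y) => //.
  by rewrite (mutationVK HA).
rewrite big_map mutationE (expansion_head hs He) -(expansion_max hs He).
rewrite {1}xE mulmx_sumr scaler_suml -big_split; apply: eq_bigr => y _ /=.
by rewrite (mutationK HA) mutationE [RHS]scalerDr scalemxAr scalerA.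
Qed.

Lemma expansion_mutationV i s x S t : coxword (i :: s) ->
  expansion A d (rcons s i) (mut i x) S t ->
  expansion A d (i :: s) x (map (mutV i) S) (t \o mut i).
Proof.
move=> hs [HC Ht H0 xE].
(* The pulled-back sum is an expansion of some vector; pushing it forward and using injectivity of
   the mutation shows that this vector is [x]. *)
have He : expansion A d (i :: s) (\sum_(y <- map (mutV i) S) (t \o mut i) y *: y)
    (map (mutV i) S) (t \o mut i).
  split=> // [|y|y Hy].
  - exact: compat_set_mutationV.
  - exact: Ht.
  - apply: H0; apply: contra Hy => Hy; apply/mapP; exists (mut i y) => //.
    by rewrite (mutationK HA).
have [_ _ _ E] := expansion_mutation hs He.
have := He; suff <- : x = \sum_(y <- map (mutV i) S) (t \o mut i) y *: y by [].
apply: (can_inj (mutationK HA i)); rewrite E xE !big_map; apply: eq_bigr => y _.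
by rewrite /= (mutationVK HA) (mutationVK HA).
Qed.

Lemma reach_cat u v x : (forall p, ~ reach A p (u ++ v) x) ->
  forall p, ~ reach A p (v ++ u) (W (rev u) *m x).
Proof.
elim: u v x => [|i u IH] v x Hr p; first by rewrite cats0 mul1mx; apply: Hr.
rewrite rev_cons wordmx_rcons -mulmxA -cat_rcons.
by apply: IH => q Hq; apply: (Hr q.+1); rewrite /= rcons_cat.
Qed.

(** A coordinate that vanishes at its turn makes the reflection fix the vector, so each letter still
    sees the original [x]. *)
Lemma prefix_coord_eq0 s x :
  (forall u i v, s = u ++ i :: v -> (W (rev u) *m x) i 0 = 0) ->
  forall i, i \in s -> x i 0 = 0.
Proof.
elim: s => // i s IH Hs.
have xi : x i 0 = 0 by have := Hs [::] i s erefl; rewrite mul1mx.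
have sx : sr i *m x = x by rewrite srefE xi scale0r subr0.
move=> j; rewrite inE => /predU1P [-> //|]; apply: IH => u k v E.
by have := Hs (i :: u) k v; rewrite E rev_cons wordmx_rcons -mulmxA sx; apply.
Qed.

Lemma periodic_monotone_const (a : nat -> R) N : (0 < N)%N -> a N = a 0%N ->
  (forall k, a k <= a k.+1) -> a 1%N = a 0%N.
Proof.
move=> N0 HN Ha; apply/le_anti; rewrite Ha andbT -HN.
have H k l : a k <= a (k + l)%N.
  by elim: l => [|l IH]; rewrite ?addn0 // addnS (le_trans IH).
by case: N N0 {HN} => // N _; rewrite -add1n H.
Qed.

(* Along a full turn the source coordinates of [x] pair [c^k (1 - c) omega_i]
   with [x]; these vectors telescope to 0 over the order of [c]. *)
Lemma reach_ex s x : coxword s -> x != 0 -> exists p, reach A p s x.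
Proof.
case: (HA) => _ _ Hd _ _.
move=> hs; apply: contraNP => Hn; have {}Hn p : ~ reach A p s x by move=> ?; apply: Hn; exists p.
have [N N0 HN] := wordmx_order HA (rev s).
set y := cpow (W (rev s)) ^~ x.
have yS k : y k.+1 = W (rev s) *m y k by [].
have Hy k p : ~ reach A p s (y k).
  elim: k p => [|k IH] p; first exact: Hn.
  by rewrite yS -[s in reach A p s]cat0s; apply: reach_cat; rewrite cats0.
apply/eqP/colP => i; rewrite [RHS]mxE.
apply: (@prefix_coord_eq0 s) (coxword_mem i hs) => u j v sE.
have ju : j \notin u /\ j \notin v.
  have := coxword_uniq hs; rewrite sE cat_uniq /= => /and3P [_ + /andP [-> _]].
  by rewrite negb_or => /andP [-> _].
have Hc z : d j * (W (rev u) *m z) j 0 = B (om j) z - B (om j) (W (rev s) *m z).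
  rewrite -(wform_alphal HA) -[in RHS](wform_wordmxl HA) -(wform_wordmxl HA).
  rewrite -wformBl; congr (B _ z).
  rewrite sE wordmx_cat wordmx_cons -!mulmxA wordmx_omega_notin; last by case: ju.
  rewrite sref_omega mulmxBr wordmx_omega_notin; last by case: ju.
  by rewrite opprB addrC subrK.
have Hle k : (W (rev u) *m y k) j 0 <= 0.
  rewrite leNgt; apply/negP => H0.
  have := @reach_cat u (j :: v) (y k); rewrite -sE => /(_ (Hy k) 0%N).
  by apply.
have Hmon k : B (om j) (y k) <= B (om j) (y k.+1).
  by rewrite -subr_le0 yS -Hc pmulr_rle0.
have HyN : y N = y 0%N by apply: HN.
have := @periodic_monotone_const (fun k => B (om j) (y k)) N N0.
rewrite HyN => /(_ erefl Hmon) /eqP; rewrite yS eq_sym -subr_eq0 -Hc.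
by rewrite mulf_eq0 gt_eqF //= => /eqP.
Qed.

(** While [y] is not the source weight, mutation acts on it by s_i, exactly as in [reach], and
    carries its coefficient along in both expansions. A positive source coordinate forces [y] to be
    omega_i, whose coefficient is determined by [x]. *)
Lemma reach_expansion_unique p s y : coxword s -> coxPi A s y -> reach A p s y ->
  forall x S t S' t', expansion A d s x S t -> expansion A d s x S' t' -> t y = t' y.
Proof.
elim: p s y => [|p IH] [//|i s] y hs Hy Hr x S t S' t' He He'.
all: have [->|[y0 yE]] := mutation_cases HA hs Hy;
  first by rewrite -(expansion_head hs He) -(expansion_head hs He').
  by move: Hr => /=; rewrite ltNge y0.
have := IH (rcons s i) (mut i y) (coxword_rot hs) (coxPi_mutation HA hs Hy) _ _ _ _ _ _
  (expansion_mutation hs He) (expansion_mutation hs He').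
by rewrite /= (mutationK HA); apply; rewrite yE.
Qed.

Lemma expansion_unique s x S t S' t' : coxword s -> expansion A d s x S t ->
  expansion A d s x S' t' -> t =1 t'.
Proof.
move=> hs He He' y; have [Hy|Hy] := EM (coxPi A s y).
  have [p Hp] := reach_ex hs (coxPi_neq0 HA Hy).
  exact: (reach_expansion_unique hs Hy Hp He He').
have H0 T : compat_set A d s T -> y \notin T.
  by move=> [_ HP _]; apply/negP => /HP.
case: He => HC _ H1 _; case: He' => HC' _ H1' _.
by rewrite H1 ?H1' //; apply: H0.
Qed.

End Expansions.

(** * Decoupling a vertex and existence of expansions *)

(* Disconnects the vertex [i] from the diagram, keeping the rank. *)
Definition decouple (n : nat) (A : 'M[int]_n) (i : 'I_n) : 'M[int]_n :=
  \matrix_(a, b) if (a == i) (+) (b == i) then 0 else A a b.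

Section Decouple.
Variables (R : realType) (n : nat) (A : 'M[int]_n) (d : 'I_n -> R) (i : 'I_n).
Hypothesis HA : cartan_datum A d.
Local Notation A' := (decouple A i).
Local Notation om := (@omega R n).
Implicit Types (x y : 'cV[R]_n) (s u : seq 'I_n) (j k : 'I_n).

Lemma decoupleE j k : j != i -> k != i -> A' j k = A j k.
Proof. by move=> /negbTE ji /negbTE ki; rewrite mxE ji ki. Qed.

Lemma decouple0 j : j != i -> A' i j = 0.
Proof. by move=> /negbTE ji; rewrite mxE eqxx ji. Qed.

(** The new quadratic form is the old one on the vector with i-th entry erased, plus 2 d_i x_i^2. *)
Lemma decouple_datum : cartan_datum A' d.
Proof.
case: (HA) => H2 Hn Hd Hs Hpos; split=> //.
- by move=> j; rewrite mxE addbb.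
- by move=> j k jk; rewrite mxE; case: ifP => // _; apply: Hn.
- by move=> j k; rewrite !mxE addbC; case: ifP => // _; rewrite !mulr0.
move=> x [j xj]; pose y k := if k == i then 0 else x k.
have E : \sum_a \sum_b x a * (d a * (A' a b)%:~R) * x b =
    \sum_a \sum_b y a * (d a * (A a b)%:~R) * y b + 2 * d i * x i ^+ 2.
  rewrite (bigD1 i) //= [X in _ = X + _](bigD1 i) //=.
  rewrite (bigD1 i) //= [X in _ + X + _]big1; last first.
    by move=> b bi; rewrite decouple0 // !mulr0 mul0r.
  rewrite [X in _ = X + _ + _]big1; last first.
    by move=> b _; rewrite /y eqxx !mul0r.
  rewrite add0r [RHS]addrC addr0; congr (_ + _).
    by rewrite mxE addbb H2 expr2; ring.
  apply: eq_bigr => a ai.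
  rewrite (bigD1 i) //= [RHS](bigD1 i) //= [y i]/y eqxx mulr0; congr (_ + _).
    by rewrite mxE eqxx (negbTE ai) /= !mulr0 mul0r.
  by apply: eq_bigr => b bi; rewrite decoupleE // /y (negbTE ai) (negbTE bi).
rewrite E; have [xi|xi] := eqVneq (x i) 0.
  rewrite xi expr2 !mulr0 addr0; apply: Hpos; exists j; rewrite /y.
  by case: ifP => // /eqP ji; move: xj; rewrite ji xi eqxx.
apply: ltr_wpDl; last first.
  by apply: mulr_gt0; [exact: mulr_gt0 | rewrite exprn_even_gt0].
have [[k yk]|Hy] := EM (exists k, y k != 0); first by apply/ltW/Hpos; exists k.
rewrite big1 // => a _; rewrite big1 // => b _.
have [->|ya] := eqVneq (y a) 0; first by rewrite !mul0r.
by case: Hy; exists a.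
Qed.

Let HA' := decouple_datum.

(** The simple roots other than alpha_i agree for both matrices except in the i-th coordinate, which
    reflections at other vertices never read. *)
Lemma decouple_wordmx u x y x0 y0 : i \notin u ->
  (forall j, j != i -> x j 0 = y j 0) ->
  (forall j, rootcoef A (x - x0) j = rootcoef A' (y - y0) j) ->
  (forall j, j != i -> (wordmx R A u *m x) j 0 = (wordmx R A' u *m y) j 0) /\
  (forall j, rootcoef A (wordmx R A u *m x - x0) j
           = rootcoef A' (wordmx R A' u *m y - y0) j).
Proof.
move=> + Hxy Hrc; elim: u => [|k u IH]; first by rewrite !mul1mx.
rewrite inE negb_or eq_sym => /andP [ki /IH {IH}[IH1 IH2]].
rewrite -!mulmxA; set z := _ *m x in IH1 IH2 *; set w := _ *m y in IH1 IH2 *.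
split=> j; last first.
  rewrite 2!rootcoefB (rootcoef_sref HA) (rootcoef_sref HA') IH1 //.
  by rewrite addrAC -rootcoefB IH2 rootcoefB addrAC.
by move=> ji; rewrite !sref_mulmxE !IH1 // decoupleE.
Qed.

(* [x] has the same coordinates with respect to both matrices, although the
   simple roots differ as vectors. *)
Lemma decouple_coxdiff s x : i \notin s -> x i 0 = 0 ->
  forall j, rootcoef A (coxdiff A (i :: s) x) j = rootcoef A' (coxdiff A' (i :: s) x) j.
Proof.
move=> Hi xi; rewrite /coxdiff rev_cons !wordmx_rcons -!mulmxA.
rewrite !srefE xi !scale0r subr0.
have [|||_] := @decouple_wordmx (rev s) x x x x; rewrite ?mem_rev //.
by move=> j; rewrite subrr !rootcoef0.
Qed.

(** In the decoupled diagram these roots have i-th coordinate 0, so letters i act trivially and can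
    be skipped; the other letters lift to the original diagram. *)
Lemma decouple_root_other u k : k != i -> exists b,
  [/\ is_root A b,
      forall j, rootcoef A b j = rootcoef A' (wordmx R A' u *m alpha R A' k) j,
      forall j, j != i -> b j 0 = (wordmx R A' u *m alpha R A' k) j 0
    & (wordmx R A' u *m alpha R A' k) i 0 = 0].
Proof.
move=> ki; elim: u => [|l u [b [Hb H1 H2 H3]]].
  exists (alpha R A k); rewrite !mul1mx; split=> [|j|j ji|].
  - exact: is_root_alpha.
  - by rewrite (rootcoef_alpha HA) (rootcoef_alpha HA').
  - by rewrite !alphaE decoupleE.
  - by rewrite alphaE decouple0.
rewrite /= -!mulmxA; set y := _ *m alpha R A' k in H1 H2 H3 *.
have [->|li] := eqVneq l i.
  by exists b; rewrite (srefE _ i y) H3 scale0r subr0.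
exists (sref R A l *m b); split=> [|j|j ji|].
- by rewrite -wordmx1; apply: is_root_wordmx.
- by rewrite (rootcoef_sref HA) (rootcoef_sref HA') H1 H2.
- by rewrite !sref_mulmxE !H2 // decoupleE.
- by rewrite sref_mulmxE H3 decouple0 // mulr0 subr0.
Qed.

Lemma decouple_root_self u :
  rootcoef A' (wordmx R A' u *m alpha R A' i) i != 0.
Proof.
have H2 : A' i i = 2 by case: HA' => ->.
suff [->|->] : wordmx R A' u *m alpha R A' i = alpha R A' i \/
    wordmx R A' u *m alpha R A' i = - alpha R A' i.
- by rewrite (rootcoef_alpha HA') eqxx oner_eq0.
- by rewrite rootcoefN (rootcoef_alpha HA') eqxx oppr_eq0 oner_eq0.
elim: u => [|l u IH]; first by left; rewrite mul1mx.
rewrite /= -mulmxA; have [->|li] := eqVneq l i.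
  by case: IH => ->; rewrite ?mulmxN (sref_alpha HA') ?opprK; [right|left].
have E : sref R A' l *m alpha R A' i = alpha R A' i.
  by rewrite srefE alphaE mxE eqxx (negbTE li) scale0r subr0.
by case: IH => ->; rewrite ?mulmxN E; [left|right].
Qed.

Lemma decouple_pos_root (b b' : 'cV[R]_n) : pos_root A' b' -> rootcoef A' b' i = 0 ->
  (forall j, rootcoef A b j = rootcoef A' b' j) -> pos_root A b.
Proof.
move=> [[u [k b'E]] Hp] b'i Hb; have [ki|ki] := eqVneq k i.
  by rewrite ki in b'E; move: (decouple_root_self u); rewrite -b'E b'i eqxx.
have [a [Ha H1 _ _]] := decouple_root_other u ki.
have -> : b = a by apply: (rootcoef_inj HA) => j; rewrite Hb H1 b'E.
by split=> // j; rewrite H1 -b'E.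
Qed.

Lemma decouple_coxPi s x : i \notin s -> x i 0 = 0 ->
  coxPi A' (i :: s) x -> coxPi A (i :: s) x.
Proof.
move=> Hi xi [Ho|Hp]; [by left | right].
apply: (decouple_pos_root Hp); last exact: decouple_coxdiff.
by rewrite (coxdiff_head HA') // xi oppr0.
Qed.

Lemma decouple_half_degree s x y : i \notin s -> x i 0 = 0 ->
  half_degree A d (i :: s) x y = half_degree A' d (i :: s) x y.
Proof.
move=> Hi xi; rewrite /half_degree; case: ifP => // _.
have -> // : wform A d (coxdiff A (i :: s) x) y = wform A' d (coxdiff A' (i :: s) x) y.
by apply: eq_bigr => j _; rewrite decouple_coxdiff.
Qed.

(** As x_i = 0, omega_i has coefficient 0, and the other members contribute nonpositive terms to x_i
    that sum to 0. Members with nonzero i-th coordinate thus have coefficient 0 and may be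
    discarded; for the rest both diagrams give the same degrees. *)
Lemma decouple_expansion s x S t : coxword (i :: s) -> x i 0 = 0 ->
  expansion A' d (i :: s) x S t ->
  expansion A d (i :: s) x [seq y : 'cV[R]_n <- S | y i 0 == 0] t.
Proof.
move=> hs xi He; have := He => -[[HU HP HG] Ht H0 xE].
have Hi := coxword_notin hs.
have ti : t (om i) = 0 by rewrite -(expansion_head HA' hs He) xi maxxx.
have Hy (y : 'cV[R]_n) : y \in S -> t y * y i 0 = 0.
  move=> yS; have [->|/eqP ne] := eqVneq y (om i); first by rewrite ti mul0r.
  have Hle (z : 'cV[R]_n) : z \in S -> t z * z i 0 <= 0.
    move=> zS; have [->|/eqP ne'] := eqVneq z (om i); first by rewrite ti mul0r.
    apply: mulr_ge0_le0 => //.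
    exact: (coxPi_head_le0 HA' Hi (HP _ zS) ne').
  have : \sum_(z <- S) - (t z * z i 0) = 0.
    rewrite sumrN; move: xi; rewrite xE summxE => E.
    by apply/eqP; rewrite oppr_eq0 -[X in _ == X]E; apply/eqP/eq_bigr => z _; rewrite mxE.
  move=> /eqP; rewrite big_seq psumr_eq0 => [/allP /(_ y yS)|z zS].
    by rewrite yS oppr_eq0 => /eqP.
  by rewrite oppr_ge0 Hle.
split=> //.
- split; first by rewrite filter_uniq.
    by move=> y; rewrite mem_filter => /andP [/eqP yi yS]; apply: decouple_coxPi (HP _ yS).
  move=> y z; rewrite !mem_filter => /andP [/eqP yi yS] /andP [/eqP zi zS] yz.
  by rewrite -(HG y z yS zS yz) /sym_degree !decouple_half_degree.
- move=> y; rewrite mem_filter negb_and => /orP [yi|/H0 //].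
  have [yS|/H0 //] := boolP (y \in S).
  by have /eqP := Hy y yS; rewrite mulf_eq0 (negbTE yi) orbF => /eqP.
rewrite {1}xE big_filter (bigID (fun y : 'cV_n => y i 0 == 0)) /=.
rewrite [X in _ + X]big1_seq ?addr0 // => y /andP [yi yS].
have /eqP := Hy y yS; rewrite mulf_eq0 (negbTE yi) orbF => /eqP ->.
by rewrite scale0r.
Qed.

End Decouple.

(** * Existence of compatible expansions *)

Section Existence.
Variables (R : realType) (n : nat).
Implicit Types (A : 'M[int]_n) (d : 'I_n -> R) (x y : 'cV[R]_n) (s : seq 'I_n).

Lemma expansion_add_omega A d i s x S t : cartan_datum A d -> coxword (i :: s) ->
  0 < x i 0 -> expansion A d (i :: s) (x - x i 0 *: omega R i) S t ->
  (forall y : 'cV[R]_n, y \in S -> y i 0 = 0) ->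
  exists S' t', expansion A d (i :: s) x S' t'.
Proof.
move=> HA hs x0 [[HU HP HG] Ht H0 xE] HS.
have Hi := coxword_notin hs.
have oS : omega R i \notin S.
  by apply/negP => /HS/eqP; rewrite omegaE eqxx oner_eq0.
have Go y : y \in S -> sym_degree A d (i :: s) y (omega R i) = 0.
  move=> yS; rewrite (sym_degree_omega HA Hi (HP _ yS)) ?HS ?mulr0 ?oppr0 //.
  by move=> yo; rewrite -yo yS in oS.
exists (omega R i :: S), (fun y => if y == omega R i then x i 0 else t y); split.
- split; first by rewrite /= oS.
    by move=> y; rewrite inE => /predU1P [->|/HP //]; left; apply: is_omega_omega.
  move=> y z; rewrite !inE => /predU1P [->|yS] /predU1P [->|zS]; rewrite ?eqxx //.
  - by move=> _; rewrite sym_degreeC Go.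
  - by move=> _; rewrite Go.
  - exact: HG.
- by move=> y; case: ifP => // _; apply: ltW.
- by move=> y; rewrite inE negb_or => /andP [/negbTE -> /H0].
rewrite big_cons eqxx -[LHS](subrK (x i 0 *: omega R i)) addrC xE; congr (_ + _).
apply: eq_big_seq => y yS; case: eqP => // yo; by rewrite -yo yS in oS.
Qed.

Definition isolated A (K : {set 'I_n}) := forall k j, k \in K -> j != k -> A k j = 0.

(* Induction on the number of vertices that are not known to be isolated. *)
Lemma expansion_ex A d (K : {set 'I_n}) s x : cartan_datum A d -> isolated A K ->
  coxword s -> (forall k, k \in K -> x k 0 = 0) -> exists S t, expansion A d s x S t.
Proof.
have [N] := ubnP #|~: K|; elim: N => // N IH in A K s x *.
move=> HN HA HK hs Hx; have [->|x0] := eqVneq x 0.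
  by exists [::], (fun=> 0); split; rewrite ?big_nil.
(* A vertex with positive coordinate lies outside [K]; decoupling it after subtracting its weight
   lowers the count. *)
have base i s' y : coxword (i :: s') -> (forall k, k \in K -> y k 0 = 0) ->
    0 < y i 0 -> exists S t, expansion A d (i :: s') y S t.
  move=> hs' Hy yi.
  have iK : i \notin K by apply/negP => /Hy y0; rewrite y0 ltxx in yi.
  have y0 : (y - y i 0 *: omega R i) i 0 = 0.
    by rewrite !mxE !eqxx mulr1 subrr.
  have [] := IH (decouple A i) (i |: K) (i :: s') (y - y i 0 *: omega R i) => //.
  - rewrite -ltnS; apply: leq_trans HN; rewrite ltnS; apply: proper_card.
    by rewrite properC; apply/properP; split; [apply: subsetUr | exists i; rewrite ?setU11].
  - exact: decouple_datum.
  - move=> k j; rewrite !inE => /predU1P [->|kK] jk; first exact: decouple0.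
    by rewrite mxE; case: ifP => // _; apply: HK.
  - move=> k; rewrite !inE => /predU1P [-> //|kK].
    rewrite 3!mxE omegaE (Hy k kK).
    have /negbTE -> : k != i by apply: contra iK => /eqP <-.
    by rewrite mulr0 subr0.
  move=> S [t He]; apply: (expansion_add_omega HA hs' yi).
    exact: (decouple_expansion HA hs' y0 He).
  by move=> z; rewrite mem_filter => /andP [/eqP].
(* Inner induction on the turns: while the source coordinate is nonpositive, mutation is s_i, which
   keeps the coordinates on [K] zero. *)
have [p] := reach_ex HA hs x0; elim: p => [|p IHp] in s x hs Hx {x0} *.
  by case: s hs => // i s hs; apply: base.
case: s hs => // i s hs; case: (ltrP 0 (x i 0)) => [xi|xi /= Hr]; first by move=> _; apply: base.
have Hx' k : k \in K -> (sref R A i *m x) k 0 = 0.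
  move=> kK; rewrite sref_mulmxE (Hx k kK) sub0r; have [ik|ik] := eqVneq i k.
    by rewrite ik (Hx k kK) mul0r oppr0.
  by rewrite (HK k i) // mulr0 oppr0.
have [S [t]] := IHp _ _ (coxword_rot hs) Hx' Hr.
rewrite -mutation_le0 // => He.
by exists (map (mutationV A i) S), (t \o mutation A i); apply: (expansion_mutationV HA).
Qed.

End Existence.

(** * Orbits of the Coxeter element *)

(* The inverse of [tau c] on [Pi(c)], see [tauVK]. *)
Definition tauV (R : realType) (n : nat) (A : 'M[int]_n) (s : seq 'I_n)
  (x : 'cV[R]_n) : 'cV[R]_n :=
  if is_omega x then - x else wordmx R A (rev s) *m x.

Definition mutation_word (R : realType) (n : nat) (A : 'M[int]_n) (s : seq 'I_n)
  (x : 'cV[R]_n) : 'cV[R]_n := foldl (fun y i => mutation A i y) x s.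

Section Orbits.
Variables (R : realType) (n : nat) (A : 'M[int]_n) (d : 'I_n -> R).
Hypothesis HA : cartan_datum A d.
Local Notation om := (@omega R n).
Local Notation al := (@alpha R n A).
Local Notation W := (@wordmx R n A).
Local Notation rc := (@rootcoef R n A).
Local Notation cd := (@coxdiff R n A).
Local Notation mut := (@mutation R n A).
Local Notation G := (@sym_degree R n A d).
Local Notation coxPi := (@coxPi R n A).
Local Notation tauV := (@tauV R n A).
Implicit Types (x y : 'cV[R]_n) (s u v : seq 'I_n) (i j : 'I_n).

Lemma tauE (c : 'M[R]_n) x : tau c x = if is_omega (- x) then - x else c *m x.
Proof.
rewrite /tau /is_omega; congr (if _ then _ else _).
by apply: eq_existsb => i; rewrite eqr_oppLR.
Qed.

Lemma coxdiff_wordmx s x : cd s (W s *m x) = W s *m cd s x.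
Proof. by rewrite /coxdiff mulmxBr (wordmxK HA) (wordmxVK HA). Qed.

Lemma coxdiff_wordmxV s x : cd s (W (rev s) *m x) = W (rev s) *m cd s x.
Proof. by rewrite /coxdiff mulmxBr. Qed.

Lemma coxdiff_cox_omega_pos s j : coxword s -> pos_root A (cd s (W s *m om j)).
Proof.
move=> /(coxword_split j) [s1 [s2 [-> H1 H2]]].
have -> : cd (s1 ++ j :: s2) (W (s1 ++ j :: s2) *m om j) = W s1 *m al j.
  rewrite /coxdiff (wordmxK HA) wordmx_cat wordmx_cons -!mulmxA.
  rewrite wordmx_omega_notin // sref_omega mulmxBr wordmx_omega_notin //.
  by rewrite opprB addrC subrK.
have Hr : is_root A (W s1 *m al j) by apply/is_root_wordmx/is_root_alpha.
split=> //; have [//|Hn] := root_pos_or_neg HA Hr.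
have := Hn j; rewrite rootcoefN (rootcoef_wordmx_notin HA) //.
by rewrite (rootcoef_alpha HA) eqxx ler0N1.
Qed.

(** If c made the root of [x] negative, some letter j would meet it as alpha_j. Undoing the letters
    before that gives minus the root of omega_j, so [x] would be - omega_j. *)
Lemma coxPi_tau_root s x : coxword s -> coxPi s x -> ~~ is_omega (- x) ->
  pos_root A (cd s (W s *m x)).
Proof.
move=> hs [/omegaP [j ->] _|Hp Ho]; first exact: coxdiff_cox_omega_pos.
rewrite coxdiff_wordmx.
have [//|[s1 [j [s2 [sE Hj]]]]] := pos_root_wordmx HA s Hp.
have [js1 js2] : j \notin s1 /\ j \notin s2.
  have := coxword_uniq hs; rewrite sE cat_uniq /= => /and3P [_ + /andP [-> _]].
  by rewrite negb_or => /andP [-> _].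
case/negP: Ho; apply/omegaP; exists j; apply: (coxdiff_inj HA hs).
by rewrite coxdiffN {2}sE coxdiff_omega_split // -Hj (wordmxK HA).
Qed.

Lemma coxPi_tau s x : coxword s -> coxPi s x -> coxPi s (tau (W s) x).
Proof.
move=> hs Hx; rewrite tauE; have [Ho|Ho] := boolP (is_omega (- x)); first by left.
by right; apply: coxPi_tau_root.
Qed.

Lemma tauK s x : coxword s -> coxPi s x -> tauV s (tau (W s) x) = x.
Proof.
move=> hs Hx; rewrite tauE; have [Ho|Ho] := boolP (is_omega (- x)).
  by rewrite /tauV Ho opprK.
have /(coxPi_omegaF HA hs)/negbTE E := coxPi_tau_root hs Hx Ho.
by rewrite /tauV E (wordmxK HA).
Qed.

Lemma coxPi_wordmxV_omegaF s x : coxword s -> coxPi s x -> ~~ is_omega x ->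
  ~~ is_omega (- (W (rev s) *m x)).
Proof.
move=> hs Hx Ho; apply/omegaP => -[j xj]; have Hp := coxPi_root Hx Ho.
apply: (pos_root_negF HA Hp).
have -> : x = - (W s *m om j) by rewrite -xj mulmxN opprK (wordmxVK HA).
by rewrite coxdiffN opprK; case: (coxdiff_cox_omega_pos j hs).
Qed.

Lemma tauVK s x : coxword s -> coxPi s x -> tau (W s) (tauV s x) = x.
Proof.
move=> hs Hx; rewrite /tauV tauE; have [Ho|Ho] := boolP (is_omega x).
  by rewrite opprK Ho.
by rewrite (negbTE (coxPi_wordmxV_omegaF hs Hx Ho)) (wordmxVK HA).
Qed.

Lemma mutation_word_cons i u x : mutation_word A (i :: u) x = mutation_word A u (mut i x).
Proof. by []. Qed.

Lemma mutation_word_coxPi u v x : coxword (u ++ v) -> coxPi (u ++ v) x ->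
  coxPi (v ++ u) (mutation_word A u x).
Proof.
elim: u v x => [|i u IH] v x hs Hx; first by rewrite cats0.
rewrite mutation_word_cons -cat_rcons; apply: IH; first by rewrite -rcons_cat; apply: coxword_rot.
by rewrite -rcons_cat; apply: (coxPi_mutation HA).
Qed.

Lemma mutation_word_degree u v x y : coxword (u ++ v) -> coxPi (u ++ v) x ->
  coxPi (u ++ v) y ->
  G (v ++ u) (mutation_word A u x) (mutation_word A u y) = G (u ++ v) x y.
Proof.
elim: u v x y => [|i u IH] v x y hs Hx Hy; first by rewrite cats0.
rewrite !mutation_word_cons -cat_rcons IH -?rcons_cat //.
- exact: (sym_degree_mutation HA).
- exact: coxword_rot.
- exact: (coxPi_mutation HA).
- exact: (coxPi_mutation HA).
Qed.

Lemma mutation_omega_neq i j : i != j -> mut i (om j) = om j.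
Proof.
by move=> ij; rewrite mutation_le0 ?sref_omega_neq // omegaE (negbTE ij).
Qed.

Lemma mutation_opp_omega_neq i j : i != j -> mut i (- om j) = - om j.
Proof.
move=> ij; rewrite mutation_le0 ?mulmxN ?sref_omega_neq //.
by rewrite mxE omegaE (negbTE ij) oppr0.
Qed.

Lemma mutation_word_omega u j : uniq u -> j \in u -> mutation_word A u (om j) = - om j.
Proof.
have opp l w : l \notin w -> mutation_word A w (- om l) = - om l.
  elim: w => // k w IH; rewrite inE negb_or eq_sym => /andP [kl lw].
  by rewrite mutation_word_cons mutation_opp_omega_neq // IH.
elim: u => // k u IH; rewrite cons_uniq => /andP [ku uu]; rewrite inE => /predU1P [->|ju].
  by rewrite mutation_word_cons mutation_omega opp.
rewrite mutation_word_cons mutation_omega_neq ?IH //.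
by apply: contra ku => /eqP ->.
Qed.

Lemma mutation_word_other u v x : coxword (u ++ v) -> coxPi (u ++ v) x ->
  (forall j, j \in u -> x <> om j) -> mutation_word A u x = W (rev u) *m x.
Proof.
elim: u v x => [|i u IH] v x hs Hx Ho; first by rewrite mul1mx.
have xi : x <> om i by apply: Ho; rewrite mem_head.
have [//|[_ E]] := mutation_cases HA hs Hx.
rewrite mutation_word_cons E rev_cons wordmx_rcons -mulmxA; apply: (IH (rcons v i)).
- by rewrite -rcons_cat; apply: coxword_rot.
- by rewrite -rcons_cat -E; apply: (coxPi_mutation HA).
move=> j ju sx; have ij : i != j.
  by apply/eqP => ij; have /= := coxword_uniq hs; rewrite mem_cat ij ju.
apply: (Ho j); first by rewrite inE ju orbT.
by rewrite -(srefK HA i x) sx sref_omega_neq.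
Qed.

(* One full turn of mutations at the successive sources is the inverse of [tau]. *)
Lemma mutation_word_tauV s x : coxword s -> coxPi s x -> mutation_word A s x = tauV s x.
Proof.
move=> hs Hx; rewrite /tauV; have [/omegaP [j ->]|Ho] := boolP (is_omega x).
  by rewrite mutation_word_omega ?coxword_uniq ?coxword_mem.
apply: (@mutation_word_other s [::]); rewrite ?cats0 // => j _ xj.
by case/negP: Ho; apply/omegaP; exists j.
Qed.

Lemma coxPi_tauV s x : coxword s -> coxPi s x -> coxPi s (tauV s x).
Proof.
move=> hs Hx; rewrite -mutation_word_tauV //.
by apply: (@mutation_word_coxPi s [::]); rewrite cats0.
Qed.

Lemma sym_degree_tauV s x y : coxword s -> coxPi s x -> coxPi s y ->
  G s (tauV s x) (tauV s y) = G s x y.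
Proof.
move=> hs Hx Hy; rewrite -!mutation_word_tauV //.
by have := @mutation_word_degree s [::] x y; rewrite cats0; apply.
Qed.

Lemma cpowS (c : 'M[R]_n) k x : cpow c k.+1 x = c *m cpow c k x.
Proof. by []. Qed.

Lemma cpowSr (c : 'M[R]_n) k x : cpow c k.+1 x = cpow c k (c *m x).
Proof. exact: iterSr. Qed.

Lemma cpowD (c : 'M[R]_n) k l x : cpow c (k + l) x = cpow c k (cpow c l x).
Proof. exact: iterD. Qed.

Lemma cpow_wordmxK s k x : cpow (W s) k (cpow (W (rev s)) k x) = x.
Proof.
elim: k x => // k IH x.
by rewrite cpowSr cpowS (wordmxVK HA) IH.
Qed.

Lemma cpow_increasing_fixed s x :
  (forall k, pos_vec A (cpow (W s) k.+1 x - cpow (W s) k x)) -> W s *m x = x.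
Proof.
move=> Hp; have [M M0 HM] := wordmx_order HA s.
apply: (rootcoef_inj HA) => j.
have := @periodic_monotone_const R (fun k => rc (cpow (W s) k x) j) M M0.
rewrite HM => /(_ erefl); apply => k.
by rewrite -subr_ge0 -rootcoefB; apply: Hp.
Qed.

(** Until the negative of a fundamental weight appears, c^k omega_i - c^(k+1) omega_i is a positive
    root; finite order of c forbids this for all k. *)
Lemma omega_orbit_end s i : coxword s -> exists m j,
  [/\ cpow (W s) m (om i) = - om j,
      forall k, (k <= m)%N -> coxPi s (cpow (W s) k (om i))
    & forall k, (k < m)%N -> ~~ is_omega (- cpow (W s) k (om i))].
Proof.
move=> hs; set y := cpow (W s) ^~ (om i).
have Hstep m : (forall k, (k < m)%N -> ~~ is_omega (- y k)) ->
    forall k, (k <= m)%N -> coxPi s (y k).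
  move=> Hm; elim=> [_|k IH km]; first by left; apply: is_omega_omega.
  by right; apply: coxPi_tau_root => //; [apply/IH/ltnW | apply: Hm].
have Hex : exists m, is_omega (- y m).
  apply/not_existsP => Hn.
  have Hy k : coxPi s (y k) by apply: (Hstep k) => // l _; apply/negP/Hn.
  have Hr k : pos_root A (y k - y k.+1).
    have := coxPi_tau_root hs (Hy k); rewrite /coxdiff (wordmxK HA) -cpowS.
    by apply; apply/negP/Hn.
  have [/(root_neq0 HA) H0 _] := Hr 0%N.
  suff : W s *m - om i = - om i.
    rewrite mulmxN => /oppr_inj E; case/negP: H0.
    by rewrite subr_eq0 eq_sym; apply/eqP.
  have cpowN k : cpow (W s) k (- om i) = - y k.
    by elim: k => // k IH; rewrite cpowS IH mulmxN.
  apply: cpow_increasing_fixed => k; rewrite !cpowN opprK addrC.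
  by case: (Hr k).
have [m /omegaP [j mj] Hmin] := ex_minnP Hex.
exists m, j; split; first by rewrite -mj opprK.
  by apply: Hstep => k km; apply: contraL km => /Hmin; rewrite -leqNgt.
by move=> k km; apply: contraL km => /Hmin; rewrite -leqNgt.
Qed.

(** w_0 makes all simple roots negative, so w_0^-1 takes - omega_j to a dominant weight. It lies in
    the orbit of omega_i and hence equals omega_i. *)
Lemma star_of_orbit i j t : W t *m om i = - om j -> star R A i j.
Proof.
case: (HA) => _ _ Hd _ _ Ht; have [w [Hw Hn]] := longest_ex HA.
exists (W w); split=> //.
have Hy : W (rev w) *m - om j = om i.
  rewrite -Ht mulmxA -wordmx_cat; apply: (dominant_orbit HA).
    by move=> k; rewrite omegaE ler0n.
  move=> k; rewrite wordmx_cat -mulmxA Ht -(pmulr_rge0 _ (Hd k)).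
  rewrite -(wform_alphal HA) -(wform_wordmxl HA) (wformNr HA) -wformNl wform_omegar.
  by apply: mulr_ge0; [apply: ltW | apply: Hn].
by rewrite -Hy (wordmxVK HA).
Qed.

Lemma hnum_orbit_end s i m j : coxword s -> cpow (W s) m (om i) = - om j ->
  (forall k, (k < m)%N -> ~~ is_omega (- cpow (W s) k (om i))) ->
  hnum A (W s) i m.
Proof.
move=> hs Hm Hmin; split.
  case: m Hm Hmin => // /= E _; have := opp_omega_omegaF R j.
  by rewrite -E is_omega_omega.
exists j; split.
  have [t Ht] := wordmx_cpow R A s m.
  by apply: (@star_of_orbit _ _ t); rewrite Ht.
split=> // k _ km; apply: contra (Hmin k km) => /eqP ->.
by rewrite opprK is_omega_omega.
Qed.

(** The endpoints at times h and m are negatives of dominant weights in one orbit, so they agree;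
    both numbers are then the first time that this endpoint is reached. *)
Lemma hnum_unique s i m j h : coxword s -> cpow (W s) m (om i) = - om j ->
  (forall k, (k < m)%N -> ~~ is_omega (- cpow (W s) k (om i))) ->
  hnum A (W s) i h -> h = m.
Proof.
move=> hs Hm Hmin [h0 [j' [_ [Hh Hhmin]]]].
have mh : (m <= h)%N.
  rewrite leqNgt; apply/negP => /Hmin; rewrite Hh opprK.
  by rewrite is_omega_omega.
have jj : j' = j.
  have [t Ht] := wordmx_cpow R A s (h - m).
  have E : W t *m om j = om j'.
    apply: oppr_inj; rewrite -mulmxN Ht -Hm -cpowD subnK // Hh.
  apply: (@omega_inj R); rewrite -E; apply: (dominant_orbit HA).
    by move=> k; rewrite omegaE ler0n.
  by move=> k; rewrite E omegaE ler0n.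
apply/eqP; rewrite eqn_leq mh andbT leqNgt; apply/negP => mh'.
have m0 : (0 < m)%N.
  case: m Hm {Hmin mh mh'} => // /= E; have := opp_omega_omegaF R j.
  by rewrite -E is_omega_omega.
by have := Hhmin m m0 mh'; rewrite Hm jj eqxx.
Qed.

(** Backward differences are the vectors [coxdiff], positive roots until a fundamental weight is
    met; again finite order ends the process. *)
Lemma coxPi_reach_omega s x : coxword s -> coxPi s x ->
  exists k, is_omega (cpow (W (rev s)) k x) /\
    forall l, (l < k)%N -> coxPi s (cpow (W (rev s)) l x) /\
       ~~ is_omega (cpow (W (rev s)) l x).
Proof.
move=> hs Hx; set y := cpow (W (rev s)) ^~ x.
have Hstep m : (forall k, (k < m)%N -> ~~ is_omega (y k)) ->
    forall k, (k <= m)%N -> coxPi s (y k).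
  move=> Hm; elim=> [//|k IH km]; have := coxPi_tauV hs (IH (ltnW km)).
  by rewrite /tauV (negbTE (Hm k km)).
have Hex : exists m, is_omega (y m).
  apply/not_existsP => Hn.
  have Hy k : coxPi s (y k) by apply: (Hstep k) => // l _; apply/negP/Hn.
  have Hr k : pos_root A (y k.+1 - y k).
    by apply: (coxPi_root (Hy k)); apply/negP/Hn.
  have [/(root_neq0 HA)/eqP H0 _] := Hr 0%N; apply: H0.
  apply/eqP; rewrite subr_eq0; apply/eqP.
  by apply: cpow_increasing_fixed => k; case: (Hr k).
have [m Hm Hmin] := ex_minnP Hex; exists m; split=> // l lm.
have Hl k : (k < m)%N -> ~~ is_omega (y k).
  by move=> km; apply: contraL km => /Hmin; rewrite -leqNgt.
by split; [apply: (Hstep m Hl); apply: ltnW | apply: Hl].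
Qed.

Lemma inPiP s x : coxword s -> inPi A (W s) x <-> coxPi s x.
Proof.
move=> hs; split=> [[i [h [Hh [k kh ->]]]]|Hx].
  have [m [j [Hm HP Hmin]]] := omega_orbit_end i hs.
  by apply: HP; rewrite -(hnum_unique hs Hm Hmin Hh).
have [k [/omegaP [i ki] Hk]] := coxPi_reach_omega hs Hx.
have [m [j [Hm HP Hmin]]] := omega_orbit_end i hs.
exists i, m; split; first exact: (hnum_orbit_end hs Hm Hmin).
exists k; last by rewrite -ki cpow_wordmxK.
(* If k > m, the backward orbit meets - omega_j right after a member of Pi(c) that is not
   fundamental, which [coxPi_wordmxV_omegaF] excludes. *)
rewrite leqNgt; apply/negP => mk.
have := coxPi_wordmxV_omegaF hs; have km : (k - m.+1 < k)%N by lia.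
have [Hl1 Hl2] := Hk _ km => /(_ _ Hl1 Hl2); rewrite -cpowS.
suff -> : cpow (W (rev s)) (k - m.+1).+1 x = - om j by rewrite opprK is_omega_omega.
rewrite -Hm -ki.
have -> : cpow (W (rev s)) k x
    = cpow (W (rev s)) m (cpow (W (rev s)) (k - m.+1).+1 x).
  by rewrite -cpowD; congr (cpow _ _ _); lia.
by rewrite cpow_wordmxK.
Qed.

End Orbits.

(** * Compatibility degree and the fan *)

Section CompatibilityDegree.
Variables (R : realType) (n : nat) (A : 'M[int]_n) (d : 'I_n -> R).
Hypothesis HA : cartan_datum A d.
Local Notation om := (@omega R n).
Local Notation W := (@wordmx R n A).
Local Notation rc := (@rootcoef R n A).
Local Notation B := (wform A d).
Local Notation cd := (@coxdiff R n A).
Local Notation G := (@sym_degree R n A d).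
Local Notation coxPi := (@coxPi R n A).
Local Notation tauV := (@tauV R n A).
Implicit Types (x y : 'cV[R]_n) (s : seq 'I_n) (i j : 'I_n).

Lemma coxdiff_omega_norm s i : coxword s -> B (cd s (om i)) (cd s (om i)) = 2 * d i.
Proof.
move=> /(coxword_split i) [s1 [s2 [-> H1 H2]]].
rewrite coxdiff_omega_split // wformNl (wformNr HA) opprK.
by rewrite (wform_wordmx HA) (wform_alpha HA).
Qed.

Lemma coxdiff_tauV_norm s x :
  B (cd s (tauV s x)) (cd s (tauV s x)) = B (cd s x) (cd s x).
Proof.
rewrite /tauV; case: ifP => _; last first.
  by rewrite coxdiff_wordmxV (wform_wordmx HA).
by rewrite coxdiffN wformNl (wformNr HA) opprK.
Qed.

Lemma sym_degree_omegal s i x : coxword s -> coxPi s x ->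
  G s (om i) x = d i * Num.max 0 (rc (cd s x) i).
Proof.
case: (HA) => _ _ Hd _ _ hs Hx.
rewrite /sym_degree half_degree_omegal (max_idPr (half_degree_ge0 _ _ _ _ _)).
rewrite /half_degree; case: ifP => [/omegaP [j xj]|_]; last first.
  by rewrite wform_omegar maxr_pMr ?mulr0 // ltW.
rewrite (max_idPl _) ?mulr0 // -oppr_ge0 -rootcoefN xj.
by case: (coxdiff_omega_neg HA j hs).
Qed.

(* For [x = c^k omega_i] the denominator is [2 d_i]. *)
Definition coxdegree s x y : int :=
  Num.floor (2 * G s x y / B (cd s x) (cd s x)).

Lemma coxdegree_compat_degree s : coxword s -> compat_degree A (W s) (coxdegree s).
Proof.
case: (HA) => _ _ Hd _ _ hs; split=> [x y /(inPiP HA x hs) Hx /(inPiP HA y hs) Hy|i x].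
  have Hx' := coxPi_tau HA hs Hx; have Hy' := coxPi_tau HA hs Hy.
  rewrite /coxdegree -(coxdiff_tauV_norm s (tau _ _)).
  by rewrite -(sym_degree_tauV HA hs Hx' Hy') !(tauK HA).
move=> /(inPiP HA x hs) Hx.
rewrite (invmx_wordmx HA) mulmxBl mul1mx -/(cd s x).
rewrite /coxdegree sym_degree_omegal // coxdiff_omega_norm //.
have -> : 2 * (d i * Num.max 0 (rc (cd s x) i)) / (2 * d i)
    = Num.max 0 (rc (cd s x) i).
  by have hd : d i != 0 by [rewrite gt_eqF]; field.
(* The quotient is 0 or a coefficient of a root, so it is an integer and the floor returns it
   unchanged. *)
apply: floorK; have [/omegaP [j xj]|Ho] := boolP (is_omega x).
  rewrite (max_idPl _) ?rpred0 // -oppr_ge0 -rootcoefN xj.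
  by case: (coxdiff_omega_neg HA j hs).
case: leP => _; rewrite ?rpred0 //; apply: (root_rootcoef_int HA).
by case: (coxPi_root Hx Ho).
Qed.

(** Both [f] and [sym_degree] are invariant when [x] and [y] are moved back together, until [x] is
    fundamental; there the second rule determines [f]. *)
Lemma compat_degree_eq0 s f x y : coxword s -> compat_degree A (W s) f ->
  coxPi s x -> coxPi s y -> f x y = 0 -> G s x y = 0.
Proof.
move=> hs [Hf1 Hf2] Hx; have [k [Hk Hl]] := coxPi_reach_omega HA hs Hx.
elim: k x y Hx Hk Hl => [|k IH] x y Hx Hk Hl Hy Hxy.
  case/omegaP: Hk Hxy => i /= -> /(congr1 (fun z : int => z%:~R : R)).
  rewrite Hf2; last exact/(inPiP HA y hs).
  rewrite (invmx_wordmx HA) mulmxBl mul1mx -/(cd s y) sym_degree_omegal // => ->.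
  by rewrite mulr0.
have [_ Ho] := Hl 0%N isT; rewrite /= in Ho.
have xE : tauV s x = W (rev s) *m x by rewrite /tauV (negbTE Ho).
rewrite -(sym_degree_tauV HA hs Hx Hy); apply: IH.
- exact: (coxPi_tauV HA hs Hx).
- by rewrite xE -cpowSr.
- by move=> l lk; rewrite xE -cpowSr; apply: Hl.
- exact: (coxPi_tauV HA hs Hy).
rewrite -Hf1; try exact/(inPiP HA _ hs)/(coxPi_tauV HA hs).
by rewrite !(tauVK HA).
Qed.

Lemma compatibleP s x y : coxword s -> coxPi s x -> coxPi s y ->
  compatible A (W s) x y <-> G s x y = 0.
Proof.
move=> hs Hx Hy; split=> [[f [Hf]]|H0]; first exact: (compat_degree_eq0 hs Hf Hx Hy).
exists (coxdegree s); split; first exact: coxdegree_compat_degree.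
by rewrite /coxdegree H0 mulr0 mul0r floor0.
Qed.

End CompatibilityDegree.

(** * Finitely generated cones *)

Section Cones.
Variables (R : realType) (n : nat).
Implicit Types (x y : 'cV[R]_n) (S T : seq 'cV[R]_n) (t : 'cV[R]_n -> R).

(** Bridges cones, whose coefficients are indexed by positions, and expansions, whose coefficients
    are indexed by vectors: coefficients of repeated entries are added. *)
Lemma sum_nth_undup S (t : 'I_(size S) -> R) :
  \sum_k t k *: nth 0 S k = \sum_(y <- undup S) (\sum_(k < size S | nth 0 S k == y) t k) *: y.
Proof.
under [RHS]eq_bigr => y _ do rewrite scaler_suml big_mkcond.
rewrite exchange_big; apply: eq_bigr => k _ /=.
rewrite (bigD1_seq (nth 0 S k)) ?undup_uniq ?mem_undup ?mem_nth //= eqxx.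
by rewrite big1 ?addr0 // => y /negbTE; rewrite eq_sym => ->.
Qed.

Lemma coneD S x y : cone S x -> cone S y -> cone S (x + y).
Proof.
move=> [t [Ht ->]] [u [Hu ->]]; exists (fun k => t k + u k); split.
  by move=> k; apply: addr_ge0.
by rewrite -big_split; apply: eq_bigr => k _; rewrite scalerDl.
Qed.

Lemma cone0 S : cone S 0.
Proof.
by exists (fun=> 0); split=> //; rewrite big1 // => k _; rewrite scale0r.
Qed.

Lemma cone_mem S y a : y \in S -> 0 <= a -> cone S (a *: y).
Proof.
move=> yS a0; have hk : (index y S < size S)%N by rewrite index_mem.
exists (fun k => if k == Ordinal hk then a else 0); split; first by move=> k; case: ifP.
rewrite (bigD1 (Ordinal hk)) //= eqxx nth_index // big1 ?addr0 // => k /negbTE ->.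
by rewrite scale0r.
Qed.

Lemma coneP S x : cone S x <-> exists t,
  [/\ forall y, 0 <= t y, forall y, y \notin S -> t y = 0
    & x = \sum_(y <- undup S) t y *: y].
Proof.
split=> [[t [Ht ->]]|[t [Ht _ ->]]].
  exists (fun y => \sum_(k < size S | nth 0 S k == y) t k); split.
  - by move=> y; apply: sumr_ge0.
  - move=> y yS; rewrite big_pred0 // => k; apply/negP => /eqP yk.
    by rewrite -yk mem_nth in yS.
  - exact: sum_nth_undup.
rewrite big_seq; apply: big_ind; [exact: cone0 | exact: coneD |].
by move=> y; rewrite mem_undup => yS; apply: cone_mem.
Qed.

Lemma cone_undup S x : cone (undup S) x <-> cone S x.
Proof.
rewrite !coneP (undup_id (undup_uniq S)).
by split=> -[t [Ht H0 ->]]; exists t; split=> // y; rewrite ?mem_undup => yS;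
  apply: H0; rewrite ?mem_undup.
Qed.

(** The matrix with rows [S] is row free, so its pseudo-inverse is a right inverse and any
    prescribed values are attained. *)
Lemma lin_indep_functional S (g : 'cV[R]_n -> R) : lin_indep S ->
  exists phi : 'rV[R]_n, forall y, y \in S -> (phi *m y) 0 0 = g y.
Proof.
move=> HS; pose M := \matrix_(k < size S, j < n) nth 0 S k j 0.
have HM : row_free M.
  apply: inj_row_free => v vM; apply/rowP => k; rewrite [RHS]mxE.
  apply: (HS (fun k => v 0 k)); apply/colP => j; rewrite summxE [RHS]mxE.
  have /rowP/(_ j) := vM; rewrite [LHS]mxE [RHS]mxE => E.
  by rewrite -[RHS]E; apply: eq_bigr => l _; rewrite !mxE.
pose v : 'cV[R]_(size S) := \col_k g (nth 0 S k).
have Mv : M *m (pinvmx M *m v) = v by rewrite mulmxA mulmxVp // mul1mx.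
exists (pinvmx M *m v)^T => y yS.
have hk : (index y S < size S)%N by rewrite index_mem.
have /colP/(_ (Ordinal hk)) := Mv; rewrite [RHS]mxE /= nth_index // => <-.
rewrite [LHS]mxE [RHS]mxE; apply: eq_bigr => j _; rewrite [(_^T) _ _]mxE mulrC.
by congr (_ * _); rewrite mxE nth_index.
Qed.

End Cones.

(** * Verification of the fan axioms *)

Section Fan.
Variables (R : realType) (n : nat) (A : 'M[int]_n) (d : 'I_n -> R) (s : seq 'I_n).
Hypothesis HA : cartan_datum A d.
Hypothesis hs : coxword s.
Implicit Types (x y : 'cV[R]_n) (S T : seq 'cV[R]_n) (C D : 'cV[R]_n -> Prop).

Lemma cfanP C : cfan A (wordmx R A s) C <->
  exists2 S, compat_set A d s S & forall x, C x <-> cone S x.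
Proof.
split=> [[S [HS [HG HC]]]|[S [HU HS HG] HC]].
  exists (undup S); last by move=> x; rewrite HC cone_undup.
  split; first exact: undup_uniq.
    by move=> y; rewrite mem_undup => /HS /(inPiP HA _ hs).
  move=> y z; rewrite !mem_undup => yS zS yz.
  apply/(compatibleP HA hs); [exact/(inPiP HA _ hs)/HS..|].
  exact: HG.
exists S; split; first by move=> y /HS /(inPiP HA _ hs).
split=> // y z yS zS yz; apply/(compatibleP HA hs); by [apply: HS | apply: HG].
Qed.

Lemma compat_set_sub (p : pred 'cV[R]_n) S :
  compat_set A d s S -> compat_set A d s (filter p S).
Proof.
move=> [HU HS HG]; split; first exact: filter_uniq.
  by move=> y; rewrite mem_filter => /andP [_]; apply: HS.
by move=> y z; rewrite !mem_filter => /andP [_ yS] /andP [_ zS]; apply: HG.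
Qed.

Lemma cone_expansion S x : compat_set A d s S ->
  cone S x <-> exists t, expansion A d s x S t.
Proof.
move=> HS; have [HU _ _] := HS; rewrite coneP undup_id //.
by split=> -[t []] *; exists t; split.
Qed.

(** Splitting a linear relation by sign gives two expansions of one vector. Uniqueness equates the
    positive and negative parts of each coefficient, which must then be 0. *)
Lemma compat_set_lin_indep S : compat_set A d s S -> lin_indep S.
Proof.
move=> HS t Ht; have [HU _ _] := HS.
pose p (u : 'I_(size S) -> R) y := \sum_(k < size S | nth 0 S k == y) Num.max 0 (u k).
have Hp u : expansion A d s (\sum_(k < size S) Num.max 0 (u k) *: nth 0 S k) S (p u).
  split=> // [y|y yS|].
  - by apply: sumr_ge0 => k _; rewrite le_max lexx.
  - rewrite /p big_pred0 // => k; apply/negP => /eqP yk.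
    by rewrite -yk mem_nth in yS.
  - by rewrite sum_nth_undup undup_id.
have Hpk u (k : 'I_(size S)) : p u (nth 0 S k) = Num.max 0 (u k).
  by rewrite /p (big_pred1 k) // => l; rewrite nth_uniq.
have E : \sum_(k < size S) Num.max 0 (t k) *: nth 0 S k
    = \sum_(k < size S) Num.max 0 (- t k) *: nth 0 S k.
  apply: subr0_eq; rewrite -sumrB -[RHS]Ht; apply: eq_bigr => k _.
  rewrite -scalerBl; congr (_ *: _).
  by case: (leP 0 (t k)) => h; case: (leP 0 (- t k)) => h'; lra.
move=> k; have := Hp (fun k => - t k); rewrite -E => Hn.
have := expansion_unique HA hs (Hp t) Hn (nth 0 S k); rewrite !Hpk.
by case: (leP 0 (t k)) => h; case: (leP 0 (- t k)) => h'; lra.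
Qed.

(** Uniqueness identifies the expansions of a common point over [S] and over [T], so its
    coefficients vanish outside both sets. *)
Lemma cone_inter S T x : compat_set A d s S -> compat_set A d s T ->
  (cone S x /\ cone T x) <-> cone [seq y <- S | y \in T] x.
Proof.
move=> HS HT; have HST := compat_set_sub (mem T) HS.
split=> [[/(cone_expansion _ HS) [t He] /(cone_expansion _ HT) [u Hu]]|].
  apply/(cone_expansion _ HST); exists t.
  have tu := expansion_unique HA hs He Hu.
  case: He => _ Ht H0 xE; case: Hu => _ _ H0' _.
  have Ht0 y : y \notin T -> t y = 0 by move=> yT; rewrite tu H0'.
  split=> // [y|].
    by rewrite mem_filter negb_and => /orP [/Ht0|/H0].
  rewrite big_filter big_mkcond xE; apply: eq_bigr => y _.
  by case: ifPn => // yT; rewrite Ht0 // scale0r.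
move=> /coneP [t [Ht _ ->]]; rewrite big_seq; split; apply: big_ind;
  try exact: cone0; try exact: coneD;
  by move=> y; rewrite mem_undup mem_filter => /andP [yT yS]; apply: cone_mem.
Qed.

Lemma face_inter S T C D : compat_set A d s S -> compat_set A d s T ->
  (forall x, C x <-> cone S x) -> (forall x, D x <-> cone T x) ->
  face C (fun x => C x /\ D x).
Proof.
move=> HS HT HC HD.
(* The supporting functional is 0 on the generators shared with [T] and 1 on the remaining ones of
   [S]. *)
have [phi Hphi] := lin_indep_functional (fun y => if y \in T then 0 else 1)
  (compat_set_lin_indep HS).
have phiE t : (phi *m \sum_(y <- S) t y *: y) 0 0
    = \sum_(y <- S) t y * (if y \in T then 0 else 1).
  rewrite mulmx_sumr summxE; apply: eq_big_seq => y yS.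
  by rewrite -scalemxAr mxE Hphi.
exists phi; split=> x.
  move=> /HC /(cone_expansion _ HS) [t [_ Ht _ ->]]; rewrite phiE.
  by apply: sumr_ge0 => y _; rewrite mulr_ge0 //; case: ifP.
split=> [[/HC HSx /HD HTx]|[/HC HSx phix]].
  split; first exact/HC.
  have /(cone_inter _ HS HT) : cone S x /\ cone T x by [].
  move=> /(cone_expansion _ (compat_set_sub (mem T) HS)) [t [_ _ _ ->]].
  rewrite mulmx_sumr summxE big1_seq // => y; rewrite mem_filter => /andP [_ /andP [yT yS]].
  by rewrite -scalemxAr mxE Hphi // [y \in T]yT mulr0.
split; first exact/HC.
apply/HD; suff : cone S x /\ cone T x by case.
apply/(cone_inter _ HS HT)/(cone_expansion _ (compat_set_sub (mem T) HS)).
move: HSx => /(cone_expansion _ HS) [t [_ Ht H0 xE]]; exists t.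
move: phix; rewrite xE phiE => /eqP; rewrite psumr_eq0; last first.
  by move=> y _; rewrite mulr_ge0 //; case: ifP.
move=> /allP Hall; have Ht0 y : y \in S -> y \notin T -> t y = 0.
  by move=> yS yT; have := Hall y yS; rewrite /= (negbTE yT) mulr1 => /eqP.
split=> // [|y|]; first exact: compat_set_sub.
  rewrite mem_filter negb_and => /orP [yT|/H0 //].
  by have [yS|/H0 //] := boolP (y \in S); apply: Ht0.
rewrite big_filter [RHS]big_mkcond; apply: eq_big_seq => y yS.
by case: ifPn => // yT; rewrite Ht0 // scale0r.
Qed.

(** A vanishing sum of nonnegative terms has only zero terms, so a face is generated by the
    generators on which its functional vanishes. *)
Lemma cfan_face C D : cfan A (wordmx R A s) C -> face C D -> cfan A (wordmx R A s) D.
Proof.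
move=> /cfanP [S HS HC] [phi [Hphi HD]].
have Hy y : y \in S -> 0 <= (phi *m y) 0 0.
  by move=> yS; apply/Hphi/HC; rewrite -[y]scale1r; apply: cone_mem.
pose p : pred 'cV[R]_n := fun y => (phi *m y) 0 0 == 0.
apply/cfanP; exists (filter p S); first exact: compat_set_sub.
have HSp := compat_set_sub p HS.
move=> x; rewrite HD HC (cone_expansion _ HS) (cone_expansion _ HSp); split.
  move=> [[t [_ Ht H0 xE]] phix]; exists t.
  have E : \sum_(y <- S) t y * (phi *m y) 0 0 = 0.
    rewrite -[RHS]phix xE mulmx_sumr summxE; apply: eq_bigr => y _.
    by rewrite -scalemxAr [RHS]mxE.
  move/eqP: E; rewrite big_seq psumr_eq0; last by move=> y /Hy; apply: mulr_ge0.
  move=> /allP Hall; have Ht0 y : y \in S -> ~~ p y -> t y = 0.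
    move=> yS py; have := Hall y yS; rewrite yS /= mulf_eq0 => /orP [/eqP //|].
    by rewrite -/(p y) (negbTE py).
  split=> // [y|].
    rewrite mem_filter negb_and => /orP [py|/H0 //].
    by have [yS|/H0 //] := boolP (y \in S); apply: Ht0.
  rewrite big_filter [RHS]big_mkcond xE; apply: eq_big_seq => y yS.
  by case: ifPn => // py; rewrite Ht0 // scale0r.
move=> [t [_ Ht H0 xE]]; split.
  apply/(cone_expansion _ HS); rewrite xE big_seq; apply: big_ind.
  - exact: cone0.
  - exact: coneD.
  by move=> y; rewrite mem_filter => /andP [_ yS]; apply: cone_mem.
rewrite xE mulmx_sumr summxE big1_seq // => y; rewrite mem_filter => /andP [_ /andP [/eqP py yS]].
by rewrite -scalemxAr mxE py mulr0.
Qed.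

Lemma cfan_complete_simplicial : complete_simplicial_fan (cfan A (wordmx R A s)).
Proof.
split; [|split; [|split]].
- move=> C /cfanP [S HS HC]; exists S; split=> //.
  exact: compat_set_lin_indep.
- exact: cfan_face.
- move=> C D /cfanP [S HS HC] /cfanP [T HT HD]; split; first exact: (face_inter HS HT HC HD).
  have [phi [H1 H2]] := face_inter HT HS HD HC.
  by exists phi; split=> // x; rewrite -H2; split=> -[].
move=> x; have [||S [t He]] := @expansion_ex R n A d set0 s x HA _ hs.
- by move=> k j; rewrite inE.
- by move=> k; rewrite inE.
have [HS _ _ _] := He; exists (cone S); split; first by apply/cfanP; exists S.
by apply/(cone_expansion _ HS); exists t.
Qed.

End Fan.

Theorem theorem2p2 (R : realType) (n : nat) (A : 'M[int]_n) (c : 'M[R]_n) :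
  finite_cartan R A -> coxeter A c -> complete_simplicial_fan (cfan A c).
Proof.
move=> [H1 [H2 [_ [d [H3 [H4 H5]]]]]] [s [hs ->]].
by apply: (@cfan_complete_simplicial R n A d).
Qed.
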